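(* Let $G=\bigcup_{i=1}^\infty K_i$ be a locally elliptic group, $\mu$ a left Haar measure on $G$ normalised so that $\mu(K_1)=1$, $p\in[1,\infty)$ and $\omega$ a weight on $G$. Set $a_i:=\sup\{\omega(x):x\in K_i\}$ for each $i\in\mathbb{N}$. Define two functions on $G$ by $$\omega^\sharp:=a_1\chi_{K_1}+\sum_{i=2}^\infty a_i\chi_{K_i\setminus K_{i-1}}$$ and $$\omega^\sharp_p:=(a_1+1)\chi_{K_1}+\sum_{i=2}^\infty(a_i+i^2)\,\mu(K_i\setminus K_{i-1})^{1/q}\chi_{K_i\setminus K_{i-1}},$$ where $q=\frac{p}{p-1}$ if $p>1$, and $q=1$ if $p=1$. Then $\omega^\sharp$ is a sub-additive weight on $G$, $\omega\le\omega^\sharp\le\omega^\sharp_p$, and $1/\omega^\sharp_p\in L^q(G)$. Furthermore, if the sequence of indices $([K_{i+1}:K_i])_{i=1}^\infty$ is non-decreasing, then $\omega^\sharp_p$ is a sub-additive $L^p$-weight on $G$.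
   Context: A locally compact group is locally elliptic if every compact subset generates a relatively compact subgroup. Writing ''$G=\bigcup_{i=1}^\infty K_i$ is a locally elliptic group'' means that $G$ is a non-compact locally compact group, the $K_i$ are compact open subgroups, $K_i\le K_{i+1}$ for all $i$, and $G=\bigcup_i K_i$. Such groups are unimodular. $\chi_U$ is the characteristic function of $U$. A weight on $G$ is a measurable function $\omega:G\to[1,\infty)$ that is bounded on compact sets, satisfies $\omega(xy)\le\omega(x)\omega(y)$ and $\omega(x)=\omega(x^{-1})$ for all $x,y\in G$. It is sub-additive if there is a constant $C>0$ with $\omega(xy)\le C(\omega(x)+\omega(y))$ for all $x,y\in G$. For $p\in[1,\infty)$, $L^p(G,\omega)=\{f\in L^p(G):f\omega\in L^p(G)\}$ with norm $\|f\omega\|_{L^p(G)}$. A weight $\omega$ is an $L^p$-weight if $L^p(G,\omega)$ is a Banach $*$-algebra under convolution and the involution $f^*(x)=\overline{f(x^{-1})}$ (the norm being submultiplicative possibly only up to a constant, i.e. after passing to an equivalent norm). *)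

(* Defs.v *)
From HB Require Import structures.
From mathcomp Require Import all_boot all_order all_algebra.
From mathcomp Require Import finmap.
From mathcomp Require Import all_classical all_reals all_analysis.
From mathcomp Require Import complex.

Set Implicit Arguments.
Unset Strict Implicit.
Unset Printing Implicit Defensive.

Import Order.TTheory GRing.Theory Num.Theory.
Import numFieldNormedType.Exports.

Local Open Scope classical_set_scope.
Local Open Scope ring_scope.
Local Open Scope complex_scope.

(* The point, required by the measure theory library, carries no information:
   a group has its unit. *)
HB.mixin Record isTopologicalGroup G & Group G & PointedTopological G := {
  mulg_continuous : continuous (fun z : G * G => (z.1 * z.2)%g);
  invg_continuous : continuous (fun x : G => (x^-1)%g)
}.

#[short(type="topologicalGroupType")]
HB.structure Definition TopologicalGroup :=
  {G of Group G & PointedTopological G & isTopologicalGroup G}.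

(* The group G seen as a measurable space through its Borel sigma-algebra. *)
Notation borel G := (g_sigma_algebraType (@open G)).

Section locally_elliptic.
Variable G : topologicalGroupType.
Implicit Types H K : set G.

Definition is_subgroup H : Prop :=
  [/\ H 1%g, forall x y, H x -> H y -> H (x * y)%g &
      forall x, H x -> H (x^-1)%g].

Definition left_coset (x : G) H : set G := [set (x * y)%g | y in H].

(* [K : H], with junk value 0 if there are infinitely many cosets. *)
Definition subgroup_index H K : nat :=
  #|` fset_set [set left_coset x H | x in K] |%fset.

(* K_0 is irrelevant: the sequence starts at K_1. *)
Record locally_elliptic_union (K : nat -> set G) : Prop := {
  leu_hausdorff : hausdorff_space G;
  leu_locally_compact : locally_compact [set: G];
  leu_noncompact : ~ compact [set: G];
  leu_compact : forall i, (0 < i)%N -> compact (K i);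
  leu_open : forall i, (0 < i)%N -> open (K i);
  leu_subgroup : forall i, (0 < i)%N -> is_subgroup (K i);
  leu_nondecreasing : forall i, (0 < i)%N -> K i `<=` K i.+1;
  leu_union : \bigcup_(i in [set i | (0 < i)%N]) K i = [set: G]
}.

End locally_elliptic.

Section haar.
Variables (R : realType) (G : topologicalGroupType).
Local Open Scope ereal_scope.

(* A nonzero left-invariant Radon measure. Regularity is not automatic, as G
   need not be second countable. *)
Record left_haar_measure (mu : {measure set (borel G) -> \bar R}) : Prop := {
  haar_neq0 : mu [set: borel G] != 0;
  haar_left_invariant : forall (x : G) (A : set (borel G)),
    measurable A -> mu (left_coset x A) = mu A;
  haar_compact : forall A : set G, compact A -> mu A < +oo;
  haar_outer_regular : forall A : set (borel G), measurable A ->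
    mu A = ereal_inf [set mu U | U in [set U : set G | open U /\ A `<=` U]];
  haar_inner_regular : forall U : set G, open U ->
    mu U = ereal_sup [set mu C | C in [set C : set G | compact C /\ C `<=` U]]
}.

End haar.

Section weight.
Variables (R : realType) (G : topologicalGroupType).

Record is_weight (w : G -> R) : Prop := {
  weight_measurable : measurable_fun [set: borel G] (w : borel G -> R);
  weight_ge1 : forall x, 1 <= w x;
  weight_bounded_compact : forall C : set G, compact C ->
    exists M : R, forall x, C x -> w x <= M;
  weight_mul : forall x y : G, w (x * y)%g <= w x * w y;
  weight_inv : forall x : G, w x = w (x^-1)%g
}.

Definition sub_additive (w : G -> R) : Prop :=
  exists2 C : R, 0 < C & forall x y : G, w (x * y)%g <= C * (w x + w y).

End weight.

(* "The quotient of (D, nrm) by its null vectors is a Banach *-algebra under mul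
   and star, the norm being submultiplicative up to a constant". Equality in
   the quotient is eqv; by bsa_eqv and the other fields it is a congruence for
   all the operations. *)
Record banach_star_algebra (R : realType) (V : lmodType R[i]) (D : set V)
    (eqv : V -> V -> Prop) (nrm : V -> R) (mul : V -> V -> V) (star : V -> V)
    : Prop := {
  bsa_0 : D 0;
  bsa_linear : forall (a : R[i]) f g, D f -> D g -> D (a *: f + g);
  bsa_eqv : forall f g, D f -> D g -> eqv f g <-> nrm (f - g) = 0;
  bsa_norm_ge0 : forall f, D f -> 0 <= nrm f;
  bsa_normD : forall f g, D f -> D g -> nrm (f + g) <= nrm f + nrm g;
  bsa_normZ : forall (a : R[i]) f, D f ->
    nrm (a *: f) = Normc.normc a * nrm f;
  bsa_complete : forall u : nat -> V, (forall n, D (u n)) ->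
    (forall e : R, 0 < e -> exists N : nat, forall m n : nat,
      (N <= m)%N -> (N <= n)%N -> nrm (u m - u n) < e) ->
    exists2 f, D f & (fun n => nrm (u n - f)) @ \oo --> (0 : R);
  bsa_mul : forall f g, D f -> D g -> D (mul f g);
  bsa_mulA : forall f g h, D f -> D g -> D h ->
    eqv (mul f (mul g h)) (mul (mul f g) h);
  bsa_mul_linearl : forall (a : R[i]) f g h, D f -> D g -> D h ->
    eqv (mul (a *: f + g) h) (a *: mul f h + mul g h);
  bsa_mul_linearr : forall (a : R[i]) f g h, D f -> D g -> D h ->
    eqv (mul f (a *: g + h)) (a *: mul f g + mul f h);
  bsa_normM : exists2 C : R, 0 < C &
    forall f g, D f -> D g -> nrm (mul f g) <= C * (nrm f * nrm g);
  bsa_star : forall f, D f -> D (star f);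
  bsa_star_antilinear : forall (a : R[i]) f g, D f -> D g ->
    eqv (star (a *: f + g)) (a^* *: star f + star g);
  bsa_starK : forall f, D f -> eqv (star (star f)) f;
  bsa_starM : forall f g, D f -> D g ->
    eqv (star (mul f g)) (mul (star g) (star f));
  bsa_norm_star : forall f, D f -> nrm (star f) = nrm f
}.

Section Lp_weight.
Variables (R : realType) (G : topologicalGroupType).
Variable mu : {measure set (borel G) -> \bar R}.
Implicit Types (p : R) (w : G -> R) (f g : G -> R[i]).

Definition complex_measurable f : Prop :=
  measurable_fun [set: borel G] (fun x : borel G => complex.Re (f x)) /\
  measurable_fun [set: borel G] (fun x : borel G => complex.Im (f x)).

Definition Lp_norm p f : \bar R :=
  Lnorm mu p%:E (fun x => (Normc.normc (f x))%:E).

(* Elements of L^p are represented by Borel functions; the identification of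
   almost everywhere equal functions is made in is_Lp_weight. *)
Definition Lp p : set (G -> R[i]) :=
  [set f | complex_measurable f /\ (Lp_norm p f < +oo)%E].

Definition weighted w f : G -> R[i] := fun x => f x * (w x)%:C.

Definition Lpw p w : set (G -> R[i]) :=
  [set f | Lp p f /\ Lp p (weighted w f)].

Definition Lpw_norm p w f : R := fine (Lp_norm p (weighted w f)).

Definition convolution_integrand f g (x : G) : G -> R[i] :=
  fun y => f y * g (y^-1 * x)%g.

(* (f * g)(x) = \int f(y) g(y^-1 x) dmu(y), meaningful at the points x where
   the integral converges absolutely. *)
Definition convolution f g : G -> R[i] := fun x =>
  (\int[mu]_(y in [set: borel G]) complex.Re (convolution_integrand f g x y)) +i*
  (\int[mu]_(y in [set: borel G]) complex.Im (convolution_integrand f g x y)).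

Definition convolution_exists f g : Prop :=
  {ae mu, forall x, mu.-integrable [set: borel G]
     (fun y => (Normc.normc (convolution_integrand f g x y))%:E)}.

Definition involution f : G -> R[i] := fun x => (f (x^-1)%g)^*.

Record is_Lp_weight p w : Prop := {
  Lp_weight_weight : is_weight w;
  Lp_weight_convolution : forall f g, Lpw p w f -> Lpw p w g ->
    convolution_exists f g;
  Lp_weight_algebra : banach_star_algebra (Lpw p w)
    (fun f g => ae_eq mu [set: borel G] (f : borel G -> _) g)
    (Lpw_norm p w) convolution involution
}.

End Lp_weight.

Section sharp.
Variables (R : realType) (G : topologicalGroupType).
Variable mu : {measure set (borel G) -> \bar R}.
Implicit Types (K : nat -> set G) (p : R) (w : G -> R).

(* Not the Hoelder conjugate (which is infinite) when p = 1. *)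
Definition dual_exponent p : R := if p == 1 then 1 else p / (p - 1).

Definition sup_on w K (i : nat) : R := sup [set w x | x in K i].

(* The series are finite sums at each point when the K_i are nondecreasing with
   union G. *)
Definition sharp w K : G -> R := fun x =>
  sup_on w K 1 * \1_(K 1%N) x +
  limn (fun n => \sum_(2 <= i < n) sup_on w K i * \1_(K i `\` K i.-1) x).

Definition sharp_p w K p : G -> R := fun x =>
  (sup_on w K 1 + 1) * \1_(K 1%N) x +
  limn (fun n => \sum_(2 <= i < n)
    (sup_on w K i + i%:R ^+ 2) *
    fine (mu (K i `\` K i.-1)) `^ (dual_exponent p)^-1 *
    \1_(K i `\` K i.-1) x).

End sharp.

(* Main.v *)
Require Import Defs.
From mathcomp Require Import all_boot all_order all_algebra.
From mathcomp Require Import finmap.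
From mathcomp Require Import all_classical all_reals all_analysis.
From mathcomp Require Import complex.
From mathcomp Require Import measurable_realfun.
From mathcomp Require Import ring lra.
Import Order.TTheory GRing.Theory Num.Theory.
Import numFieldNormedType.Exports.
Local Open Scope classical_set_scope.
Local Open Scope ring_scope.
Local Open Scope complex_scope.

Set Implicit Arguments.
Unset Strict Implicit.
Unset Printing Implicit Defensive.

(** Write K_n for [K n]. Both functions depend on x only through its level, that is
    through the first K_n containing x, and the level of a product is at most the
    larger of the two levels. A function of the level which is at least 1 and does not
    decrease with the level is therefore a weight W, and even W (x y) <= W x + W y
    ([level_weight]). This applies to [sharp] at once. The shell K_(n+1) \ K_n is empty
    or contains a coset of K_n, so its measure is 0 or at least 1, which gives
    [sharp <= sharp_p]; this measure is ([K_(n+1) : K_n] - 1) mu(K_n), so that it is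
    nondecreasing when the indices are, and then [sharp_p] is a weight too
    ([sharp_p_weight]). On a nonempty shell K_n \ K_(n-1) of measure m,
    sharp_p is at least n^2 m^(1/q), so that the integral of sharp_p^-q over the shell
    is at most n^-2; the sum over n is finite ([integral_sharp_pV]).

    For p > 1 subadditivity of W = sharp_p gives
    W x / (W y W(y^-1 x)) <= C (1 / W y + 1 / W(y^-1 x)), and as 1/W is in L^q,
    Hoelder's inequality bounds the function W (|f| * |g|), where * is convolution,
    at every point by a constant times the p-th
    root of (|f| W)^p * (|g| W)^p. For p = 1 the same bound is the
    submultiplicativity of W. Since the integral of a convolution of nonnegative
    functions is the product of their integrals, the p-th power of this bound can be
    integrated; so L^p(G, W) is closed under convolution and its norm is
    submultiplicative up to a constant. The other axioms follow: completeness as for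
    every L^p ([Lpw_complete]), associativity by multilinearity from the case of
    nonnegative functions, where it holds at every point ([Lp_weight_of_bound]).

    The group G is not assumed second countable. Its Borel sets may then be too many for
    (x, y) |-> f y g(y^-1 x) to be measurable for the product sigma-algebra, and
    Tonelli's theorem does not apply to convolutions. Its substitute [haar_fubini]
    rests on regularity: if A has finite measure then mu (B /\ y A) varies little with
    y, uniformly in B ([near_translate]). Cutting B into small pieces gives
    int_D mu (B /\ x A^-1) dx <= int_B mu (D /\ y A) dy for compact A. The inequality is
    its own converse after A is replaced by A^-1 and D is exchanged with B. The equality
    for D = B = K_n says that G is unimodular, which in turn extends the equality from
    compact to Borel sets A, and then to functions. *)

Local Notation normc := Normc.normc.
Local Notation Re := complex.Re.
Local Notation Im := complex.Im.

(** * Functionals on nonnegative measurable functions *)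

Section ge0_ind.
Context d (T : measurableType d) (R : realType).
Local Open Scope ereal_scope.
Import HBNNSimple.

(** Every such f is an increasing limit of simple functions, which are positive
    combinations of indicators. *)
Lemma ge0_measurable_ind (P : (T -> \bar R) -> Prop) :
  (forall A, measurable A -> P (fun x => (\1_A x)%:E)) ->
  (forall f g, measurable_fun setT f -> (forall x, 0 <= f x) ->
    measurable_fun setT g -> (forall x, 0 <= g x) ->
    P f -> P g -> P (fun x => f x + g x)) ->
  (forall (c : R) f, (0 <= c)%R -> measurable_fun setT f -> (forall x, 0 <= f x) ->
    P f -> P (fun x => c%:E * f x)) ->
  (forall (F : (T -> \bar R)^nat) f, (forall n, measurable_fun setT (F n)) ->
    (forall n x, 0 <= F n x) ->
    (forall x, {homo F^~ x : n m / (n <= m)%N >-> n <= m}) ->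
    (forall x, F^~ x @ \oo --> f x) -> (forall n, P (F n)) -> P f) ->
  forall f, measurable_fun setT f -> (forall x, 0 <= f x) -> P f.
Proof.
move=> P1 PD PZ PL f mf f0.
have [g [ndg gf]] := approximation measurableT mf (fun t _ => f0 t).
apply: (PL (fun n x => (g n x)%:E)).
- by move=> n; apply/measurable_EFinP.
- by move=> n x; rewrite lee_fin.
- by move=> x n m nm; rewrite lee_fin; have /lefP := ndg _ _ nm; exact.
- by move=> x; exact: gf.
move=> n; set h := g n; pose s := fset_set (range h).
have -> : (fun x => (h x)%:E) =
    (fun x => (\sum_(i < #|` s|) s`_i * \1_(h @^-1` [set s`_i]) x)%:E).
  by apply/funext => x; rewrite fimfunEord.
have s0 i : (i < #|` s|)%N -> (0 <= s`_i)%R.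
  move=> il; have : s`_i \in s by exact: mem_nth.
  by rewrite in_fset_set // inE => -[x _ <-].
elim: {-2}(#|`s|) (leqnn #|`s|) => [|k IH] ks.
  rewrite (_ : (fun _ => _) = (fun x => (\1_(set0 : set T) x)%:E)); first exact: P1.
  by apply/funext => x; rewrite big_ord0 indicE in_set0.
have -> : (fun x => (\sum_(i < k.+1) s`_i * \1_(h @^-1` [set s`_i]) x)%:E) =
  (fun x => (\sum_(i < k) s`_i * \1_(h @^-1` [set s`_i]) x)%:E +
     (s`_k)%:E * (\1_(h @^-1` [set s`_k]) x)%:E).
  by apply/funext => x; rewrite big_ord_recr /= EFinD EFinM.
have mi i : measurable_fun setT (fun x => (\1_(h @^-1` [set s`_i]) x)%:E : \bar R).
  by apply/measurable_EFinP; exact: measurable_indic.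
have i0 i x : 0 <= (\1_(h @^-1` [set s`_i]) x)%:E :> \bar R by rewrite lee_fin.
apply: PD.
- apply/measurable_EFinP; apply: measurable_sum => i.
  by apply: measurable_funM => //; exact: measurable_indic.
- move=> x; rewrite lee_fin sumr_ge0 // => i _; rewrite mulr_ge0 // s0 //.
  by apply: leq_trans ks; rewrite ltnS ltnW.
- by apply: emeasurable_funM => //; exact: measurable_cst.
- by move=> x; rewrite mule_ge0 // lee_fin s0.
- exact: IH (ltnW ks).
- by apply: PZ => //; [exact: s0|exact: P1].
Qed.

End ge0_ind.

Section sigma_linear.
Context d (T : measurableType d) (R : realType).
Local Open Scope ereal_scope.
Implicit Types (f g : T -> \bar R) (L : (T -> \bar R) -> \bar R).

Definition nnmeasurable f := measurable_fun setT f /\ forall x, 0 <= f x.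

(** The functionals given by integration against a measure, described without a
    measure: iterated integrals are of this kind by [sigma_linear_comp], and their
    values on indicators determine them, by [eq_sigma_linear]. *)
Record sigma_linear L : Prop := {
  sigma_linearD : forall f g, nnmeasurable f -> nnmeasurable g ->
    L (fun x => f x + g x) = L f + L g;
  sigma_linearZ : forall (c : R) f, (0 <= c)%R -> nnmeasurable f ->
    L (fun x => c%:E * f x) = c%:E * L f;
  le_sigma_linear : forall f g, nnmeasurable f -> nnmeasurable g ->
    (forall x, f x <= g x) -> L f <= L g;
  sigma_linear_cvg : forall (F : (T -> \bar R)^nat) f, (forall n, nnmeasurable (F n)) ->
    nnmeasurable f -> (forall x, {homo F^~ x : n m / (n <= m)%N >-> n <= m}) ->
    (forall x, F^~ x @ \oo --> f x) -> L \o F @ \oo --> L f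
}.

Lemma nnmeasurable_cvg (F : (T -> \bar R)^nat) f : (forall n, nnmeasurable (F n)) ->
  (forall x, F^~ x @ \oo --> f x) -> nnmeasurable f.
Proof.
move=> mF Ff; split.
  by apply: (emeasurable_fun_cvg F) => // m; case: (mF m).
move=> x; rewrite -(cvg_lim (@ereal_hausdorff R) (Ff x)).
apply: lime_ge; first by apply/cvg_ex; exists (f x); exact: Ff.
by apply: nearW => n; case: (mF n).
Qed.

Lemma eq_sigma_linear L1 L2 : sigma_linear L1 -> sigma_linear L2 ->
  (forall A, measurable A -> L1 (fun x => (\1_A x)%:E) = L2 (fun x => (\1_A x)%:E)) ->
  forall f, nnmeasurable f -> L1 f = L2 f.
Proof.
move=> s1 s2 e f [mf f0]; move: f mf f0; apply: ge0_measurable_ind => //.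
- by move=> f g mf f0 mg g0 ef eg;
    rewrite (sigma_linearD s1) ?(sigma_linearD s2) ?ef ?eg.
- by move=> c f c0 mf f0 ef; rewrite (sigma_linearZ s1) ?(sigma_linearZ s2) ?ef.
- move=> F f mF F0 ndF Ff eF.
  have nF n : nnmeasurable (F n) by [].
  have nf := nnmeasurable_cvg nF Ff.
  have h1 := sigma_linear_cvg s1 nF nf ndF Ff.
  have h2 := sigma_linear_cvg s2 nF nf ndF Ff.
  rewrite -(cvg_lim (@ereal_hausdorff R) h1) -(cvg_lim (@ereal_hausdorff R) h2).
  by have -> : L1 \o F = L2 \o F by apply/funext => n; exact: eF.
Qed.

Lemma sigma_linear_eval (y : T) : sigma_linear (fun f : T -> \bar R => f y).
Proof. by split=> //= F f _ _ _; exact. Qed.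

End sigma_linear.

Section sigma_linear_integral.
Context d (T : measurableType d) d' (S : measurableType d') (R : realType).
Variable mu : {measure set S -> \bar R}.
Local Open Scope ereal_scope.

(** The last clause is monotone convergence under both integrals. Zero factors
    are treated apart because the product is not continuous at (0, +oo). *)
Lemma sigma_linear_comp (k : S -> \bar R) (L : S -> (T -> \bar R) -> \bar R) :
  nnmeasurable k -> (forall y, sigma_linear (L y)) ->
  (forall f, nnmeasurable f -> nnmeasurable (L^~ f)) ->
  sigma_linear (fun f => \int[mu]_y (k y * L y f)).
Proof.
move=> [mk k0] sL nL; split.
- move=> f g nf ng; have [mLf Lf0] := nL f nf; have [mLg Lg0] := nL g ng.
  rewrite -ge0_integralD //.
  + apply: eq_integral => y _.
    by rewrite (sigma_linearD (sL y)) // ge0_muleDr.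
  + by move=> y _; rewrite mule_ge0.
  + exact: emeasurable_funM.
  + by move=> y _; rewrite mule_ge0.
  + exact: emeasurable_funM.
- move=> c f c0 nf; have [mLf Lf0] := nL f nf.
  rewrite -ge0_integralZl //.
  + apply: eq_integral => y _.
    by rewrite (sigma_linearZ (sL y)) // muleCA.
  + exact: emeasurable_funM.
  + by move=> y _; rewrite mule_ge0.
- move=> f g nf ng fg; have [mLf Lf0] := nL f nf; have [mLg Lg0] := nL g ng.
  apply: ge0_le_integral => //.
  + by move=> y _; rewrite mule_ge0.
  + exact: emeasurable_funM.
  + exact: emeasurable_funM.
  + by move=> y _; rewrite lee_wpmul2l //; exact: (le_sigma_linear (sL y)).
- move=> F f nF nf ndF Ff.
  have <- : \int[mu]_y limn (fun n => k y * L y (F n)) = \int[mu]_y (k y * L y f).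
    apply: eq_integral => y _; apply/cvg_lim => //.
    have LF := sigma_linear_cvg (sL y) nF nf ndF Ff.
    have ndL : {homo (fun n => L y (F n)) : n m / (n <= m)%N >-> n <= m}.
      by move=> n m nm; apply: (le_sigma_linear (sL y)) => // x; exact: ndF.
    have [ky0|ky0] := eqVneq (k y) 0.
      rewrite ky0 mul0e (_ : (fun _ => _) = cst 0); first exact: cvg_cst.
      by apply/funext => n; rewrite mul0e.
    have [Ly0|Ly0] := eqVneq (L y f) 0.
      rewrite Ly0 mule0 (_ : (fun _ => _) = cst 0); first exact: cvg_cst.
      apply/funext => n; suff -> : L y (F n) = 0 by rewrite mule0.
      apply/eqP; rewrite eq_le (nL _ (nF n)).2 andbT -Ly0.
      have LFs := ereal_nondecreasing_cvgn ndL.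
      rewrite (cvg_unique (@ereal_hausdorff R) LF LFs).
      by apply: ereal_sup_ubound; exists n.
    apply: cvgeM => //; last exact: cvg_cst.
    by rewrite mule_defE (negbTE ky0) (negbTE Ly0).
  apply: (@cvg_monotone_convergence _ _ _ mu setT measurableT (fun n y =>
      k y * L y (F n))) => //.
  + by move=> n; apply: emeasurable_funM => //; case: (nL _ (nF n)).
  + by move=> n y _; rewrite mule_ge0 // (nL _ (nF n)).2.
  + by move=> y _ n m nm; rewrite lee_wpmul2l //;
      apply: (le_sigma_linear (sL y)) => // x; exact: ndF.
Qed.

End sigma_linear_integral.

(** * Borel sets of a topological group *)

Section borel_group.
Variable G : topologicalGroupType.
Implicit Types (A B D U : set G).

(** The set yA, written as a preimage under a continuous map. *)
Definition translate A (y : G) : set G := [set x | A (y^-1 * x)%g].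
Definition invs A : set G := [set x | A (x^-1)%g].

Lemma invsK A : invs (invs A) = A.
Proof. by apply/seteqP; split=> x; rewrite /invs /= invgK. Qed.

Lemma translate_invs A x y : translate (invs A) x y <-> translate A y x.
Proof. by rewrite /translate /invs /= invgM invgK. Qed.

Lemma left_cosetE A y : left_coset y A = translate A y.
Proof.
apply/seteqP; split=> [x [z Az <-]|x Ax]; first by rewrite /translate /= mulKg.
by exists (y^-1 * x)%g => //; rewrite mulVKg.
Qed.

Lemma open_borel_measurable U : open U -> measurable (U : set (borel G)).
Proof. exact: sub_sigma_algebra. Qed.

Lemma closed_borel_measurable U : closed U -> measurable (U : set (borel G)).
Proof.
move=> cU; rewrite -(setCK U); apply: measurableC; apply: open_borel_measurable.
by rewrite openC.
Qed.

Lemma continuous_borel (f : G -> G) :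
  continuous f -> measurable_fun setT (f : borel G -> borel G).
Proof.
move=> cf; apply: (@measurability _ _ (borel G) (borel G) setT f (@open G)) =>
    // _ [U oU <-].
rewrite setTI; apply: open_borel_measurable.
by move/continuousP: cf; exact.
Qed.

Lemma continuous_mull (y : G) : continuous (fun x : G => (y * x)%g).
Proof.
move=> x; apply: (@continuous_comp _ _ _ (fun x : G => (y,
    x)) (fun z : G * G => (z.1 * z.2)%g)).
  by apply: cvg_pair; [exact: cvg_cst|exact: cvg_id].
exact: mulg_continuous.
Qed.

Lemma continuous_mulr (y : G) : continuous (fun x : G => (x * y)%g).
Proof.
move=> x; apply: (@continuous_comp _ _ _ (fun x : G => (x,
    y)) (fun z : G * G => (z.1 * z.2)%g)).
  by apply: cvg_pair; [exact: cvg_id|exact: cvg_cst].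
exact: mulg_continuous.
Qed.

Lemma measurable_mull (y : G) :
  measurable_fun setT ((fun x : G => (y * x)%g) : borel G -> borel G).
Proof. by apply: continuous_borel; exact: continuous_mull. Qed.

Lemma measurable_invg :
  measurable_fun setT ((fun x : G => (x^-1)%g) : borel G -> borel G).
Proof. by apply: continuous_borel; exact: invg_continuous. Qed.

Lemma measurable_invg_mul (x : G) :
  measurable_fun setT ((fun y : G => (y^-1 * x)%g) : borel G -> borel G).
Proof.
apply: continuous_borel => y.
apply: (@continuous_comp _ _ _ (fun y : G => (y^-1)%g) (fun z : G => (z * x)%g)).
  exact: invg_continuous.
exact: continuous_mulr.
Qed.

Lemma measurable_translate A y :
  measurable (A : set (borel G)) -> measurable (translate A y : set (borel G)).
Proof.
by move=> mA; have := measurable_mull y^-1%g measurableT mA; rewrite setTI.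
Qed.

Lemma measurable_invs A :
  measurable (A : set (borel G)) -> measurable (invs A : set (borel G)).
Proof. by move=> mA; have := measurable_invg measurableT mA; rewrite setTI. Qed.

Lemma compact_invs A : compact A -> compact (invs A).
Proof.
move=> cA; have -> : invs A = (fun x : G => (x^-1)%g) @` A.
  apply/seteqP; split=> [x Ax|_ [x Ax <-]]; last by rewrite /invs /= invgK.
  by exists (x^-1)%g => //; rewrite invgK.
apply: continuous_compact => //; apply: continuous_subspaceT.
exact: invg_continuous.
Qed.

(** The tube lemma for the multiplication near {1} x A. *)
Lemma compact_near1_mul A U : compact A -> open U -> A `<=` U ->
  \forall n \near (1%g : G), forall a, A a -> U (n * a)%g.
Proof.
move=> /compact_near_coveringP cA oU AU.
apply: (cA G (nbhs (1%g : G)) (fun n a => U (n * a)%g)) => a Aa.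
have nU : nbhs ((1%g : G) * a)%g U by rewrite mul1g; apply/open_nbhs_nbhs;
    split=> //; exact: AU.
have [[P Q] [nP nQ] PQ] := (@mulg_continuous G (1%g, a)) _ nU.
exists (Q, P) => // -[b n] [/= Qb Pn]; exact: (PQ (n, b)).
Qed.

Lemma near1_inv (P : G -> Prop) :
  (\forall n \near (1%g : G), P n) -> \forall n \near (1%g : G), P (n^-1)%g.
Proof.
by move=> nP; have := @invg_continuous G 1%g; rewrite /continuous_at invg1; apply.
Qed.

Lemma openP_near1 (V : set G) :
  (forall x, V x -> \forall n \near (1%g : G), V (x * n)%g) -> open V.
Proof.
move=> h; rewrite openE => x /h nV; rewrite /interior.
have := @continuous_mull x^-1%g x; rewrite /continuous_at /= mulVg => /(_ _ nV).
move=> nV'; suff -> : V = [set y | V (x * (x^-1 * y))%g] by exact: nV'.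
by apply/seteqP; split=> y /=; rewrite mulVKg.
Qed.

End borel_group.

(** * Regularity of Haar measure and Fubini's theorem for compact sets *)

Section haar_fubini.
Variables (R : realType) (G : topologicalGroupType) (K : nat -> set G).
Hypothesis hK : locally_elliptic_union K.
Variable mu : {measure set (borel G) -> \bar R}.
Hypothesis hmu : left_haar_measure mu.
Hypothesis hmu1 : mu (K 1%N) = 1%E.
Implicit Types A B D U : set G.

Local Notation bmeasurable A := (measurable (A : set (borel G))).

Lemma leu_le i j : (0 < i)%N -> (i <= j)%N -> K i `<=` K j.
Proof.
move=> i0 /subnK <-; elim: (j - i)%N => [|k IH]; first by rewrite add0n.
by rewrite addSn; apply: (subset_trans IH); apply: (leu_nondecreasing hK);
    rewrite addn_gt0 i0 orbT.
Qed.

Lemma leu_measurable n : bmeasurable (K n.+1).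
Proof. by apply: open_borel_measurable; apply: (leu_open hK). Qed.
Hint Resolve leu_measurable : core.

Lemma leu_cover : \bigcup_n K n.+1 = [set: G].
Proof.
rewrite -subTset -(leu_union hK) => x [[//|i] _ Kx]; by exists i.
Qed.

Lemma haar_K_fin n : (mu (K n.+1) < +oo)%E.
Proof. by apply: (haar_compact hmu); apply: (leu_compact hK). Qed.

Lemma haar_K_ge1 n : (1 <= mu (K n.+1))%E.
Proof.
by rewrite -hmu1; apply: le_measure; rewrite ?inE //; apply: leu_le.
Qed.

Lemma haar_translate A y : bmeasurable A -> mu (translate A y) = mu A.
Proof. by move=> mA; rewrite -left_cosetE (haar_left_invariant hmu). Qed.

Lemma le_haar A B : bmeasurable A -> bmeasurable B -> A `<=` B -> (mu A <= mu B)%E.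
Proof. by move=> mA mB AB; apply: le_measure; rewrite ?inE. Qed.

Lemma haar_U2 A B : bmeasurable A -> bmeasurable B ->
  (mu (A `|` B) <= mu A + mu B)%E.
Proof. by move=> mA mB; exact: measureU2. Qed.

Lemma haar_bounded_fin n A : bmeasurable A -> A `<=` K n.+1 -> (mu A < +oo)%E.
Proof. by move=> mA AK; apply: le_lt_trans (haar_K_fin n); apply: le_haar. Qed.

Lemma haar_outer A (e : R) : bmeasurable A -> (mu A < +oo)%E -> 0 < e ->
  exists U : set G, [/\ open U, A `<=` U & (mu (U `\` A) < e%:E)%E].
Proof.
move=> mA fA e0.
have fnA : mu A \is a fin_num by rewrite ge0_fin_numE.
have := fnA; rewrite (haar_outer_regular hmu mA) => h.
have [_ [U [oU AU] <-]] := lb_ereal_inf_adherent e0 h.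
rewrite -(haar_outer_regular hmu mA) => Ue; exists U; split => //.
have mU := open_borel_measurable oU.
have fU : (mu U < +oo)%E by apply: (lt_trans Ue); rewrite lte_add_pinfty // ltry.
rewrite measureD // setIidr // lteBlDl //.
Qed.

(** Inner regularity is outer regularity of the complement of A inside the
    compact open subgroup [K n.+1]. *)
Lemma haar_regular n A (e : R) : bmeasurable A -> A `<=` K n.+1 -> 0 < e ->
  exists C U : set G, [/\ compact C, open U, C `<=` A, A `<=` U &
    (mu (U `\` C) < e%:E)%E].
Proof.
move=> mA AK e0; have e20 : 0 < e / 2 by rewrite divr_gt0.
have [U [oU AU Ue]] := haar_outer mA (haar_bounded_fin mA AK) e20.
have mKA : bmeasurable (K n.+1 `\` A) by apply: measurableD.
have [V [oV KAV Ve]] := haar_outer mKA (haar_bounded_fin mKA (@subDsetl _ _ _)) e20.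
have cK := leu_compact hK (ltn0Sn n).
have clC : closed (K n.+1 `\` V).
  by apply: closedI; [exact: compact_closed (leu_hausdorff hK) cK|rewrite closedC].
have mU := open_borel_measurable oU.
have mV := open_borel_measurable oV.
have mC := closed_borel_measurable clC.
exists (K n.+1 `\` V), U; split=> //.
- by apply: (subclosed_compact clC cK); exact: subDsetl.
- by move=> x [Kx nVx]; apply: contrapT => nAx; apply: nVx; apply: KAV.
- apply: (@le_lt_trans _ _ (mu ((U `\` A) `|` (V `\` (K n.+1 `\` A))))).
    apply: le_haar; first by apply: measurableD.
      by apply: measurableU; apply: measurableD.
    move=> x [Ux nC]; have [Ax|nAx] := pselect (A x); last by left.
    right; split; last by case.
    by apply: contrapT => nV; apply: nC; split=> //; exact: AK.
  apply: (@le_lt_trans _ _ (mu (U `\` A) + mu (V `\` (K n.+1 `\` A)))%E).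
    by apply: haar_U2; apply: measurableD.
  by rewrite (splitr e) EFinD lteD.
Qed.

(** Let C <= A <= U with C compact, U open and mu (U \ C) < e, and let v be so
    close to 1 that v C <= U. A point of x v A outside x A lies in x (U \ A) or in
    x v (A \ C), two sets whose measures add up to at most mu (U \ C). The bound is
    uniform in x and B. *)
Lemma near_translate n A (e : R) : bmeasurable A -> A `<=` K n.+1 -> 0 < e ->
  \forall v \near (1%g : G), forall B x, bmeasurable B ->
    (mu (B `&` translate A (x * v)%g) <= mu (B `&` translate A x) + e%:E)%E.
Proof.
move=> mA AK e0; have [C [U [cC oU CA AU UC]]] := haar_regular mA AK e0.
have mU := open_borel_measurable oU.
have mC := closed_borel_measurable (compact_closed (leu_hausdorff hK) cC).
near=> v => B x mB.
have vC : forall c, C c -> U (v * c)%g.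
  by near: v; apply: compact_near1_mul => //; apply: subset_trans AU.
have UA y : translate A (x * v)%g y -> ~ translate A x y ->
    translate (U `\` A) x y \/ translate (A `\` C) (x * v)%g y.
  rewrite /translate /= invgM => Avy nAy.
  have [Cy|nCy] := pselect (C (v^-1 * x^-1 * y)%g); [left|by right].
  by split=> //; have := vC _ Cy; rewrite -mulgA mulVKg.
have mt D y : bmeasurable D ->
    bmeasurable (translate D y) := @measurable_translate _ D y.
have mUA : bmeasurable (U `\` A) by apply: measurableD.
have mAC : bmeasurable (A `\` C) by apply: measurableD.
apply: (@le_trans _ _ (mu ((B `&` translate A x) `|`
    (translate (U `\` A) x `|` translate (A `\` C) (x * v)%g)))).
  apply: le_haar.
  - by apply: measurableI => //; apply: mt.
  - apply: measurableU; first by apply: measurableI => //; apply: mt.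
    by apply: measurableU; apply: mt.
  - move=> y [By Ay]; have [Axy|nAxy] := pselect (translate A x y); first by left.
    by right; apply: UA.
apply: (le_trans (haar_U2 _ _)).
- by apply: measurableI => //; apply: mt.
- by apply: measurableU; apply: mt.
rewrite leeD2l //; apply: (le_trans (haar_U2 _ _)); [exact: mt|exact: mt|].
rewrite !haar_translate //; apply: (@le_trans _ _ (mu (U `\` C))); last exact: ltW.
rewrite -measureU //; first apply: le_haar.
- exact: measurableU.
- exact: measurableD.
- move=> y [[Uy nAy]|[Ay nCy]]; first by split=> // /CA.
  by split=> //; exact: (AU y).
- by rewrite -subset0 => y [[_ nAy] [Ay _]].
Unshelve. all: by end_near. Qed.

(** By [near_translate] the function is upper semicontinuous. *)
Lemma measurable_translate_bounded n A B : bmeasurable A -> A `<=` K n.+1 ->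
  bmeasurable B ->
  measurable_fun [set: borel G] (fun x : borel G => mu (B `&` translate A x)).
Proof.
move=> mA AK mB; apply: (measurability _ (ErealGenInftyO.measurableE R)).
move=> _ [_ [r ->] <-]; rewrite setTI; apply: open_borel_measurable.
apply: openP_near1 => x /=; rewrite !in_itv /= => xr.
have fx : mu (B `&` translate A x) \is a fin_num.
  rewrite ge0_fin_numE //; apply: le_lt_trans (haar_bounded_fin mA AK).
  by rewrite -(haar_translate x mA); apply: le_haar; [apply: measurableI => //;
      exact: measurable_translate|exact: measurable_translate|exact: subIsetr].
have e0 : 0 < (r - fine (mu (B `&` translate A x))) / 2.
  by rewrite divr_gt0 // subr_gt0 -lte_fin fineK.
apply: filterS (near_translate mA AK e0) => v /(_ B x mB) h /=.
rewrite in_itv /=; apply: (le_lt_trans h).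
rewrite -[X in (X + _)%E](fineK fx) -EFinD lte_fin.
have : fine (mu (B `&` translate A x)) < r by rewrite -lte_fin fineK.
set t := fine _; lra.
Qed.

(** The measure that {(x, y) in D x B : x^-1 y in A} should have. This set need
    not belong to the product sigma-algebra when G is not second countable, so the
    order of integration matters a priori. *)
Definition overlap D B A := (\int[mu]_(x in D) mu (B `&` translate A x))%E.

Lemma overlap_setU2 n D B B' A : bmeasurable A -> A `<=` K n.+1 ->
  bmeasurable D -> bmeasurable B -> bmeasurable B' -> B `&` B' = set0 ->
  overlap D (B `|` B') A = (overlap D B A + overlap D B' A)%E.
Proof.
move=> mA AK mD mB mB' BB'; rewrite /overlap -ge0_integralD //.
- apply: eq_integral => x _; rewrite setIUl measureU //.
  + by apply: measurableI => //; exact: measurable_translate.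
  + by apply: measurableI => //; exact: measurable_translate.
  + by rewrite setIACA BB' set0I.
- by apply: measurable_funTS; apply: (measurable_translate_bounded mA AK mB).
- by apply: measurable_funTS; apply: (measurable_translate_bounded mA AK mB').
Qed.

Lemma overlap_setU1 n D D' B A : bmeasurable A -> A `<=` K n.+1 ->
  bmeasurable D -> bmeasurable D' -> bmeasurable B -> D `&` D' = set0 ->
  overlap (D `|` D') B A = (overlap D B A + overlap D' B A)%E.
Proof.
move=> mA AK mD mD' mB DD'; rewrite /overlap ge0_integral_setU //.
- by apply: measurable_funTS; apply: (measurable_translate_bounded mA AK mB).
- by rewrite disj_set2E DD'.
Qed.

Lemma overlap_le_diff n D B A C : bmeasurable A -> A `<=` K n.+1 ->
  bmeasurable C -> C `<=` A -> bmeasurable D -> bmeasurable B ->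
  (overlap D B A <= overlap D B C + mu (A `\` C) * mu D)%E.
Proof.
move=> mA AK mC CA mD mB; have CK := subset_trans CA AK.
rewrite /overlap -integral_cst // -ge0_integralD //; first last.
  by apply: measurable_funTS; apply: (measurable_translate_bounded mC CK mB).
have mAC : bmeasurable (A `\` C) by apply: measurableD.
have mt E x : bmeasurable E ->
    bmeasurable (translate E x) := @measurable_translate _ E x.
apply: ge0_le_integral => //.
- by apply: measurable_funTS; apply: (measurable_translate_bounded mA AK mB).
- apply: emeasurable_funD => //.
  by apply: measurable_funTS; apply: (measurable_translate_bounded mC CK mB).
- move=> x _; rewrite -(haar_translate x mAC).
  apply: (@le_trans _ _ (mu ((B `&` translate C x) `|` translate (A `\` C) x))).
    apply: le_haar.
    + by apply: measurableI => //; exact: mt.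
    + by apply: measurableU; [apply: measurableI => //; exact: mt|exact: mt].
    + move=> y [By Ay]; have [Cy|nCy] := pselect (C (x^-1 * y)%g); first by left.
      by right.
  by apply: haar_U2; [apply: measurableI => //; exact: mt|exact: mt].
Qed.

Lemma le_overlap n D B A C : bmeasurable A -> A `<=` K n.+1 ->
  bmeasurable C -> C `<=` A -> bmeasurable D -> bmeasurable B ->
  (overlap D B C <= overlap D B A)%E.
Proof.
move=> mA AK mC CA mD mB; have CK := subset_trans CA AK.
apply: ge0_le_integral => //.
- by apply: measurable_funTS; apply: (measurable_translate_bounded mC CK mB).
- by apply: measurable_funTS; apply: (measurable_translate_bounded mA AK mB).
- move=> x _; apply: le_haar.
  + by apply: measurableI => //; exact: measurable_translate.
  + by apply: measurableI => //; exact: measurable_translate.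
  + by move=> y [By Cy]; split=> //; exact: CA.
Qed.

Lemma leu_invs n A : A `<=` K n.+1 -> invs A `<=` K n.+1.
Proof.
move=> AK x Ax; rewrite -[x]invgK; have [_ _ VK] := leu_subgroup hK (ltn0Sn n).
by apply: VK; exact: AK.
Qed.

(** B is small here, in that y A <= y0 U for all y in B. Hence x A^-1 can only
    meet B when x is in y0 U, and the left-hand side is at most
    mu B * mu (D /\ y0 U). For y in B this last measure exceeds mu (D /\ y A) by at
    most 2 e: one e for U \ A and one for the passage from y0 to y. *)
Lemma overlap_invs_le_piece n D B A U (e : R) y0 :
  bmeasurable A -> A `<=` K n.+1 -> open U -> U `<=` K n.+1 -> A `<=` U ->
  (mu (U `\` A) <= e%:E)%E -> bmeasurable D -> bmeasurable B -> (mu B < +oo)%E ->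
      0 < e ->
  (forall y, B y -> (forall a, A a -> U (y0^-1 * y * a)%g) /\
     (mu (D `&` translate A y0) <= mu (D `&` translate A y) + e%:E)%E) ->
  (overlap D B (invs A) <= overlap B D A + (2 * e)%:E * mu B)%E.
Proof.
move=> mA AK oU UK AU Ue mD mB fB e0 hB.
have mU := open_borel_measurable oU.
have mt E x : bmeasurable E ->
    bmeasurable (translate E x) := @measurable_translate _ E x.
have mUA : bmeasurable (U `\` A) by apply: measurableD.
have mDA x : bmeasurable (D `&` translate A x) by apply: measurableI => //; exact: mt.
have mDU x : bmeasurable (D `&` translate U x) by apply: measurableI => //; exact: mt.
apply: (@le_trans _ _ (mu B * mu (D `&` translate U y0))%E).
  rewrite /overlap.
  rewrite -integral_cst; last by exact: mDU.
  rewrite [leRHS]integral_mkcondr /=.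
  apply: ge0_le_integral => //.
  - apply: measurable_funTS; apply: (measurable_translate_bounded (n := n)) => //.
    + exact: measurable_invs.
    + exact: leu_invs.
  - by apply/(measurable_restrict _ (mt _ _ mU)) => //; apply: measurable_cst.
  - move=> x Dx; rewrite patchE; case: ifPn => [_|nU].
      by apply: le_haar => //; apply: measurableI => //; apply: mt;
          apply: measurable_invs.
    move: nU; rewrite notin_setE => nUx;
        suff -> : B `&` translate (invs A) x = set0 by rewrite measure0.
    rewrite -subset0 => y [By /translate_invs Ay]; apply: nUx.
    by have [+ _] := hB _ By => /(_ _ Ay); rewrite /translate /= -mulgA mulVKg.
rewrite muleC -integral_cst // -integral_cst // -ge0_integralD //; first last.
- by move=> x _; rewrite lee_fin mulr_ge0 // ltW.
- by apply: measurable_funTS; apply: (measurable_translate_bounded mA AK mD).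
apply: ge0_le_integral => //.
  apply: emeasurable_funD => //.
  by apply: measurable_funTS; apply: (measurable_translate_bounded mA AK mD).
move=> y By; have [_ h] := hB _ By.
apply: (@le_trans _ _ (mu (D `&` translate A y0) + e%:E)%E); last first.
  by rewrite mulr_natl mulr2n EFinD addeA leeD2r.
apply: (@le_trans _ _ (mu ((D `&` translate A y0) `|` translate (U `\` A) y0))%E).
  apply: le_haar => //; first by apply: measurableU => //; exact: mt.
  by move=> x [Dx Ux]; have [Ax|nAx] := pselect (A (y0^-1 * x)%g); [left|right].
apply: (le_trans (haar_U2 _ _)) => //; first exact: mt.
by rewrite leeD2l // haar_translate.
Qed.

(** One half of Fubini's theorem for the indicators of D, B and a compact A: B is
    cut into finitely many pieces that are small in the sense of
    [overlap_invs_le_piece]. *)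
Lemma overlap_invs_le n m D B A :
  compact A -> A `<=` K n.+1 ->
  bmeasurable D -> bmeasurable B -> B `<=` K m.+1 ->
  (overlap D B (invs A) <= overlap B D A)%E.
Proof.
move=> cA AK mD mB BK.
have mA := closed_borel_measurable (compact_closed (leu_hausdorff hK) cA).
have mAV := measurable_invs mA.
have AVK := leu_invs AK.
have fB := haar_bounded_fin mB BK.
apply/lee_addgt0Pr => e e0.
(* chosen so that 2 d * mu B <= e; the summand 1 avoids a division by 0 *)
have d0 : 0 < e / (2 * (fine (mu B) + 1)).
  by rewrite divr_gt0 // mulr_gt0 // ltr_wpDl // fine_ge0.
set d := (X in 0 < X) in d0.
have [U0 [oU0 AU0 U0d]] := haar_outer mA (haar_bounded_fin mA AK) d0.
pose U := U0 `&` K n.+1.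
have oU : open U by apply: openI => //; exact: (leu_open hK).
have UK : U `<=` K n.+1 by exact: subIsetr.
have AU : A `<=` U by move=> x Ax; split; [exact: AU0|exact: AK].
have mU := open_borel_measurable oU.
have mU0 := open_borel_measurable oU0.
have Ud : (mu (U `\` A) <= d%:E)%E.
  apply: le_trans (ltW U0d); apply: le_haar; [exact: measurableD|exact: measurableD|].
  by move=> x [[Ux _] nAx].
pose P (v : G) := (forall a, A a -> U (v * a)%g) /\
  (forall E x, bmeasurable E ->
    (mu (E `&` translate A x) <= mu (E `&` translate A (x * v)%g) + d%:E)%E).
have nP : \forall v \near (1%g : G), P v.
  apply: filterS2 (compact_near1_mul cA oU AU) (near1_inv (near_translate mA AK d0))
      => v h1 h2.
  by split=> // E x mE; rewrite -{1}(mulgK v x); exact: h2.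
pose N := interior [set v | P v].
have oN : open N by exact: open_interior.
have N1 : N 1%g by exact: nP.
have NP : N `<=` [set v | P v] by exact: interior_subset.
pose f (x : G) : set G := [set y | N (x^-1 * y)%g].
have of_ x : open (f x) by move/continuousP: (@continuous_mull G x^-1%g); exact.
have : finite_subset_cover [set: G] f (K m.+1).
  have := leu_compact hK (ltn0Sn m); rewrite compact_cover; apply => //.
  by move=> x _; exists x => //; rewrite /f /= mulVg.
move=> [s _ sK].
have : B `<=` [set y | exists2 x, x \in (s : seq G) & f x y].
  by move=> y /BK /sK [x /= xs fxy]; exists x.
suff main : forall (l : seq G) B', bmeasurable B' -> (mu B' < +oo)%E ->
    B' `<=` [set y | exists2 x, x \in l & f x y] ->
    (overlap D B' (invs A) <= overlap B' D A + (2 * d)%:E * mu B')%E.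
  move=> /(main _ B mB fB) /le_trans; apply; rewrite leeD2l //.
  rewrite -(@fineK _ (mu B)) ?ge0_fin_numE // -EFinM lee_fin.
  have t0 : 0 <= fine (mu B) by exact: fine_ge0.
  have hd : d * (2 * (fine (mu B) + 1)) = e by rewrite mulfVK //; lra.
  by rewrite -[leRHS]hd; move: (fine _) t0 => t t0; nra.
elim=> [|x l IH] B' mB' fB' B'l.
  have -> : B' = set0 by rewrite -subset0 => y /B'l [].
  rewrite measure0 mule0 adde0 /overlap integral_set0.
  rewrite (eq_integral (cst 0%E)) ?integral0 // => y _.
  by rewrite set0I measure0.
have mf : bmeasurable (f x) by exact: open_borel_measurable.
have mB1 : bmeasurable (B' `&` f x) by exact: measurableI.
have mB2 : bmeasurable (B' `\` f x) by exact: measurableD.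
have B12 : (B' `&` f x) `&` (B' `\` f x) = set0.
  by rewrite -subset0 => y [[_ ?] [_]].
have fB1 : (mu (B' `&` f x) < +oo)%E by apply: le_lt_trans fB'; apply: le_haar => //;
    exact: subIsetl.
have fB2 : (mu (B' `\` f x) < +oo)%E by apply: le_lt_trans fB'; apply: le_haar => //;
    exact: subDsetl.
have B'E : B' = (B' `&` f x) `|` (B' `\` f x) by rewrite setUIDK.
have mue : mu B' = (mu (B' `&` f x) + mu (B' `\` f x))%E.
  by rewrite {1}B'E measureU.
rewrite mue {1 2}B'E (overlap_setU2 mAV AVK) // (overlap_setU1 mA AK) //.
rewrite ge0_muleDr // [leRHS]addeACA; apply: leeD; last first.
  apply: IH => // y [B'y nf]; have [z] := B'l _ B'y.
  by rewrite inE => /orP[/eqP -> //|zl fzy]; exists z.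
apply: (overlap_invs_le_piece (n := n) (U := U) (y0 := x)) => //.
move=> y [_ fxy]; have [hU hd] := NP _ fxy; split; first exact: hU.
by have := hd D x mD; rewrite mulVKg.
Unshelve. all: by end_near. Qed.

(** For A^-1, with D and B exchanged, [overlap_invs_le] is the converse inequality. *)
Lemma overlap_invs_compact n m k D B A :
  compact A -> A `<=` K n.+1 ->
  bmeasurable D -> D `<=` K k.+1 -> bmeasurable B -> B `<=` K m.+1 ->
  overlap D B (invs A) = overlap B D A.
Proof.
move=> cA AK mD DK mB BK; apply/eqP; rewrite eq_le; apply/andP; split.
  exact: (overlap_invs_le cA AK mD mB BK).
rewrite -[X in (overlap B D X <= _)%E](invsK A).
apply: (overlap_invs_le (compact_invs cA) (leu_invs AK) mB mD DK).
Qed.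

(** A locally elliptic group is unimodular: for D = B = K n.+1, which contains A,
    the two sides of [overlap_invs_compact] are mu A^-1 and mu A times mu (K n.+1). *)
Lemma haar_invs_compact n A : compact A -> A `<=` K n.+1 -> mu (invs A) = mu A.
Proof.
move=> cA AK.
have mA := closed_borel_measurable (compact_closed (leu_hausdorff hK) cA).
have aux A' : bmeasurable A' -> A' `<=` K n.+1 ->
    overlap (K n.+1) (K n.+1) A' = (mu A' * mu (K n.+1))%E.
  move=> mA' A'K; rewrite /overlap -integral_cst //; apply: eq_integral => x.
  rewrite inE => Kx; rewrite setIidr ?haar_translate // => y A'y.
  have [_ MK _] := leu_subgroup hK (ltn0Sn n).
  by rewrite -(mulVKg x y); apply: MK => //; exact: A'K.
have := overlap_invs_compact cA AK (leu_measurable n) (@subset_refl _ _)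
    (leu_measurable n) (@subset_refl _ _).
rewrite !aux //; [|exact: measurable_invs|exact: leu_invs].
have Kfin : mu (K n.+1) \is a fin_num by rewrite ge0_fin_numE // haar_K_fin.
have K0 : (0 < mu (K n.+1))%E by apply: lt_le_trans (haar_K_ge1 n); rewrite lte_fin.
move/(congr1 (fun z => z * (fine (mu (K n.+1)))^-1%:E)%E).
rewrite -!muleA -{1 3}(fineK Kfin) -EFinM divff ?mule1 //.
by rewrite gt_eqF // fine_gt0 // K0 haar_K_fin.
Qed.

End haar_fubini.

(** * Unimodularity and measurability of convolution integrals *)

Section haar_convolution.
Variables (R : realType) (G : topologicalGroupType) (K : nat -> set G).
Hypothesis hK : locally_elliptic_union K.
Variable mu : {measure set (borel G) -> \bar R}.
Hypothesis hmu : left_haar_measure mu.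
Hypothesis hmu1 : mu (K 1%N) = 1%E.
Implicit Types A B D U : set G.

Local Notation bmeasurable A := (measurable (A : set (borel G))).
Let mK n : bmeasurable (K n.+1) := leu_measurable hK n.
Hint Resolve mK : core.

Lemma leu_exhaust_homo A : {homo (fun n =>
    A `&` K n.+1) : n m / (n <= m)%N >-> (n <= m)%O}.
Proof. by move=> n m nm; apply/subsetPset; apply: setIS; apply: (leu_le hK). Qed.

Lemma leu_exhaustE A : \bigcup_n (A `&` K n.+1) = A.
Proof. by rewrite -setI_bigcupr (leu_cover hK) setIT. Qed.

Lemma haar_exhaust_cvg A : bmeasurable A ->
  (fun n => mu (A `&` K n.+1)) @ \oo --> mu A.
Proof.
move=> mA; have := @nondecreasing_cvg_mu _ _ _ mu (fun n => A `&` K n.+1).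
rewrite leu_exhaustE; apply=> //; last exact: leu_exhaust_homo.
by move=> n; apply: measurableI.
Qed.

(** A contains compact sets of almost full measure, and their inverses are
    contained in A^-1. *)
Lemma haar_invs_bounded_le n A : bmeasurable A -> A `<=` K n.+1 ->
    (mu A <= mu (invs A))%E.
Proof.
move=> mA AK; apply/lee_addgt0Pr => e e0.
have [C [U [cC oU CA AU UC]]] := haar_regular hK hmu mA AK e0.
have mC := closed_borel_measurable (compact_closed (leu_hausdorff hK) cC).
have mU := open_borel_measurable oU.
apply: (@le_trans _ _ (mu (C `|` (U `\` C)))).
  apply: le_haar => //; first by apply: measurableU => //; exact: measurableD.
  by move=> x Ax; have [Cx|nCx] := pselect (C x); [left|right; split=> //; exact: AU].
apply: (le_trans (haar_U2 _ _ _)) => //; first exact: measurableD.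
rewrite leeD //; last exact: ltW.
rewrite -(haar_invs_compact hK hmu hmu1 cC (subset_trans CA AK)).
by apply: le_haar; [exact: measurable_invs|exact: measurable_invs|move=> x; exact: CA].
Qed.

Lemma haar_invs A : bmeasurable A -> mu (invs A) = mu A.
Proof.
move=> mA; have mVA := measurable_invs mA.
suff h n : mu (invs A `&` K n.+1) = mu (A `&` K n.+1).
  rewrite -(cvg_lim (@ereal_hausdorff R) (haar_exhaust_cvg mVA)).
  rewrite -(cvg_lim (@ereal_hausdorff R) (haar_exhaust_cvg mA)).
  by under eq_fun do rewrite h.
have E : invs (A `&` K n.+1) = invs A `&` K n.+1.
  have VK := leu_invs hK (@subset_refl _ (K n.+1)).
  apply/seteqP; split=> x [Ax Kx]; split=> //; first exact: VK.
  by apply: VK; rewrite /invs /= invgK.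
have mAK : bmeasurable (A `&` K n.+1) by exact: measurableI.
have AKK : A `&` K n.+1 `<=` K n.+1 by exact: subIsetr.
apply/eqP; rewrite -E eq_le (haar_invs_bounded_le mAK AKK) andbT.
have := haar_invs_bounded_le (measurable_invs mAK) (leu_invs hK AKK).
by rewrite invsK.
Qed.

(** A is replaced by a compact subset C; the error mu (A^-1 \ C^-1) made on the
    left is small by unimodularity. *)
Lemma overlap_invs_bounded_le n m k D B A : bmeasurable A -> A `<=` K n.+1 ->
  bmeasurable D -> D `<=` K k.+1 -> bmeasurable B -> B `<=` K m.+1 ->
  (overlap mu D B (invs A) <= overlap mu B D A)%E.
Proof.
move=> mA AK mD DK mB BK; apply/lee_addgt0Pr => e e0.
have fD := haar_bounded_fin hK hmu mD DK.
have d0 : 0 < e / (fine (mu D) + 1) by rewrite divr_gt0 // ltr_wpDl // fine_ge0.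
set d := (X in 0 < X) in d0.
have [C [U [cC oU CA AU UC]]] := haar_regular hK hmu mA AK d0.
have mC := closed_borel_measurable (compact_closed (leu_hausdorff hK) cC).
have mU := open_borel_measurable oU.
have CK := subset_trans CA AK.
have mAC : bmeasurable (A `\` C) by exact: measurableD.
have CAV : invs C `<=` invs A by move=> x; exact: CA.
apply: (le_trans (overlap_le_diff hK hmu (measurable_invs mA) (leu_invs hK AK)
    (measurable_invs mC) CAV mD mB)).
rewrite (overlap_invs_compact hK hmu cC CK mD DK mB BK).
apply: leeD; first exact: (le_overlap hK hmu mA AK mC CA mB mD).
have -> : invs A `\` invs C = invs (A `\` C) by [].
rewrite haar_invs //.
have ACd : (mu (A `\` C) <= d%:E)%E.
  apply: le_trans (ltW UC); apply: le_haar => //; first exact: measurableD.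
  by move=> x [Ax nC]; split=> //; exact: AU.
apply: (@le_trans _ _ (d%:E * mu D)%E); first exact: lee_wpmul2r.
rewrite -(@fineK _ (mu D)) ?ge0_fin_numE // -EFinM lee_fin.
have t0 : 0 <= fine (mu D) by exact: fine_ge0.
have hd : d * (fine (mu D) + 1) = e by rewrite mulfVK //; lra.
by rewrite -[leRHS]hd; move: (fine _) t0 => t t0; nra.
Qed.

Lemma overlap_invs n m k D B A : bmeasurable A -> A `<=` K n.+1 ->
  bmeasurable D -> D `<=` K k.+1 -> bmeasurable B -> B `<=` K m.+1 ->
  overlap mu D B (invs A) = overlap mu B D A.
Proof.
move=> mA AK mD DK mB BK; apply/eqP; rewrite eq_le.
rewrite (overlap_invs_bounded_le mA AK mD DK mB BK) /=.
rewrite -[X in (overlap mu B D X <= _)%E](invsK A).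
exact: (overlap_invs_bounded_le (measurable_invs mA) (leu_invs hK AK) mB BK mD DK).
Qed.

Lemma measurable_haar_translate A B : bmeasurable A -> bmeasurable B ->
  measurable_fun [set: borel G] (fun x : borel G => mu (B `&` translate A x)).
Proof.
move=> mA mB; apply: (emeasurable_fun_cvg (fun n (x : borel G) =>
    mu (B `&` translate (A `&` K n.+1) x))).
  move=> n; have mAK : bmeasurable (A `&` K n.+1) by exact: measurableI.
  exact: (measurable_translate_bounded hK hmu mAK (@subIsetr _ _ _) mB).
move=> x _; have := @nondecreasing_cvg_mu _ _ _ mu (fun n =>
    B `&` translate (A `&` K n.+1) x).
have -> : \bigcup_n (B `&` translate (A `&` K n.+1) x) = B `&` translate A x.
  rewrite -setI_bigcupr -[in RHS](leu_exhaustE A) /translate; congr (_ `&` _).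
apply.
- by move=> n; apply: measurableI => //; apply: measurable_translate;
    exact: measurableI.
- by apply: measurableI => //; exact: measurable_translate.
- move=> n m nm; apply/subsetPset; apply: setIS => y; rewrite /translate /=.
  have := @leu_exhaust_homo A _ _ nm; move/subsetPset; exact.
Qed.

Definition conv_section (S : set (borel G * borel G)) (x : G) : set (borel G) :=
  [set y : borel G | S (y, (y^-1 * x)%g)].

Lemma measurable_conv_map (x : G) :
  measurable_fun setT (fun y : borel G => (y, (y^-1 * x)%g) : borel G * borel G).
Proof.
apply: measurable_fun_pair; first exact: measurable_id.
exact: measurable_invg_mul.
Qed.

Lemma measurable_conv_section S x : measurable S -> measurable (conv_section S x).
Proof. by move=> mS; have := measurable_conv_map x measurableT mS; rewrite setTI. Qed.

(** This is not an instance of Tonelli's theorem, as (x, y) |-> y^-1 x need not be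
    measurable for the product sigma-algebra. For a rectangle S = B x A the function
    is x |-> mu (B /\ x A^-1), and [measurable_haar_translate] applies; Dynkin's
    theorem extends this to all S, inside each [K n.+1] where mu is finite. *)
Lemma measurable_haar_conv_section S : measurable S ->
  measurable_fun [set: borel G] (fun x : borel G => mu (conv_section S x)).
Proof.
move=> mS; apply: (emeasurable_fun_cvg (fun n (x : borel G) =>
    mu (conv_section S x `&` K n.+1))); last first.
  by move=> x _; apply: haar_exhaust_cvg; exact: measurable_conv_section.
move=> n.
pose P S := measurable_fun [set: borel G] (fun x : borel G =>
    mu (conv_section S x `&` K n.+1)).
have PK : P setT.
  by rewrite /P; apply: (eq_measurable_fun (cst (mu (K n.+1)))) => // x _;
      rewrite /conv_section /= setTI.
have mcK S' x : measurable S' -> measurable (conv_section S' x `&` K n.+1).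
  by move=> mS'; apply: measurableI => //; exact: measurable_conv_section.
have fcK S' x : measurable S' -> (mu (conv_section S' x `&` K n.+1) < +oo)%E.
  by move=> mS'; apply: (haar_bounded_fin hK hmu (n := n));
      [exact: mcK|exact: subIsetr].
have mp := @measurable_prod_measurableType _ _ (borel G) (borel G).
apply: (dynkin_induction (P := P) mp); last by rewrite -mp.
- move=> _ _ [A mA [B mB <-]] [A' mA' [B' mB' <-]].
  by exists (A `&` A'); [exact: measurableI|exists (B `&` B');
      [exact: measurableI|rewrite setXI]].
- exact: PK.
- move=> _ [A mA [B mB <-]]; rewrite /P.
  apply: (eq_measurable_fun (fun x : borel G =>
      mu ((A `&` K n.+1) `&` translate (invs B) x))).
    move=> x _; congr (mu _); apply/seteqP; split=> y.
      by move=> [[Ay Ky] /translate_invs By].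
    by move=> [[Ay By] Ky]; split=> //; apply/translate_invs.
  by apply: measurable_haar_translate; [exact: measurable_invs|exact: measurableI].
- move=> S' mS' PS'; rewrite /P.
  apply: (eq_measurable_fun (fun x : borel G =>
      mu (K n.+1) - mu (conv_section S' x `&` K n.+1))%E).
    move=> x _; rewrite (_ : conv_section (~` S') x `&` K n.+1 = K n.+1 `\`
        (conv_section S' x `&` K n.+1)).
      rewrite measureD //; [|exact: mcK|exact: (haar_K_fin hK hmu)].
      by congr (_ - mu _)%E; rewrite setICA setIid.
    apply/seteqP; split=> y; first by move=> [nS Ky]; split=> // -[].
    by move=> [Ky nS]; split=> // Sy; apply: nS.
  by apply: emeasurable_funB => //; exact: measurable_cst.
- move=> F mF tF PF; rewrite /P.
  apply: (emeasurable_fun_cvg (fun m (x : borel G) =>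
      \sum_(0 <= i < m) mu (conv_section (F i) x `&` K n.+1))%E).
    by move=> m; apply: emeasurable_sum => i; exact: PF.
  move=> x _.
  have -> : conv_section (\bigcup_k F k) x `&` K n.+1 = \bigcup_k (conv_section (F k)
      x `&` K n.+1).
    by rewrite -setI_bigcupl.
  apply: measure_semi_sigma_additive.
  + by move=> i; exact: mcK.
  + apply/trivIsetP => i j _ _ ij; rewrite setIACA setIid.
    rewrite (_ : _ `&` _ = set0) ?set0I // -subset0 => y [Fi Fj].
    have /trivIsetP/(_ i j I I ij) := tF.
    by rewrite -subset0 => /(_ (y, (y^-1 * x)%g)); apply.
  + by apply: bigcupT_measurable => i; exact: mcK.
Qed.

Local Open Scope ereal_scope.

(** Phi is not assumed to be a product, so that it can be the positive part of
    Re (f y * g z): a convolution has to be Borel measurable also at the points where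
    it does not converge absolutely. *)
Lemma measurable_conv_integral (Phi : borel G * borel G -> \bar R) :
  measurable_fun setT Phi -> (forall z, 0 <= Phi z) ->
  measurable_fun [set: borel G] (fun x : borel G => \int[mu]_y Phi (y, (y^-1 * x)%g)).
Proof.
move: Phi; apply: ge0_measurable_ind.
- move=> S mS; apply: (eq_measurable_fun (fun x : borel G => mu (conv_section S x))).
    move=> x _; rewrite -(setIT (conv_section S x)) -integral_indic //;
        last exact: measurable_conv_section.
  exact: measurable_haar_conv_section.
- move=> f g mf f0 mg g0 Pf Pg.
  apply: (eq_measurable_fun (fun x : borel G => \int[mu]_y f (y,
      (y^-1 * x)%g) + \int[mu]_y g (y, (y^-1 * x)%g))).
    move=> x _; rewrite -ge0_integralD //.
    + exact: measurableT_comp (measurable_conv_map x).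
    + exact: measurableT_comp (measurable_conv_map x).
  exact: emeasurable_funD.
- move=> c f c0 mf f0 Pf.
  apply: (eq_measurable_fun (fun x : borel G => c%:E * \int[mu]_y f (y, (y^-1 * x)%g))).
    move=> x _; rewrite -ge0_integralZl //.
    exact: measurableT_comp (measurable_conv_map x).
  by apply: emeasurable_funM => //; exact: measurable_cst.
- move=> F f mF F0 ndF Ff PF.
  apply: (emeasurable_fun_cvg (fun n (x : borel G) => \int[mu]_y F n (y,
      (y^-1 * x)%g))) => // x _.
  have <- : (fun y => limn (F^~ (y, (y^-1 * x)%g))) = (fun y => f (y, (y^-1 * x)%g)).
    by apply/funext => y; apply/cvg_lim => //; exact: Ff.
  apply: (@cvg_monotone_convergence _ _ _ mu setT measurableT (fun n y => F n (y,
      (y^-1 * x)%g))) => //.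
  - by move=> n; exact: measurableT_comp (measurable_conv_map x).
Qed.

End haar_convolution.

(** * Convolution of nonnegative functions *)

Section haar_integral.
Variables (R : realType) (G : topologicalGroupType) (K : nat -> set G).
Hypothesis hK : locally_elliptic_union K.
Variable mu : {measure set (borel G) -> \bar R}.
Hypothesis hmu : left_haar_measure mu.
Hypothesis hmu1 : mu (K 1%N) = 1%E.
Local Notation bmeasurable A := (measurable (A : set (borel G))).
Local Open Scope ereal_scope.
Implicit Types f g h : borel G -> \bar R.

Lemma nnmeasurable_comp d (T : measurableType d) d' (S : measurableType d')
  (phi : T -> S) (f : S -> \bar R) : measurable_fun setT phi ->
  nnmeasurable f -> nnmeasurable (f \o phi).
Proof. by move=> mphi [mf f0]; split=> [|x]; [exact: measurableT_comp|exact: f0]. Qed.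

Lemma nnmeasurableM d (T : measurableType d) (f g : T -> \bar R) :
  nnmeasurable f -> nnmeasurable g -> nnmeasurable (fun x => f x * g x).
Proof.
by move=> [mf f0] [mg g0]; split=> [|x]; [exact: emeasurable_funM|rewrite mule_ge0].
Qed.

Lemma nnmeasurable_indic d (T : measurableType d) (A : set T) :
  measurable A -> nnmeasurable (fun x => (\1_A x)%:E : \bar R).
Proof.
move=> mA; split=> [|x]; last by rewrite lee_fin.
by apply/measurable_EFinP; exact: measurable_indic.
Qed.

(** A is the increasing union of the bounded sets A /\ K n.+1. *)
Lemma eq_sigma_linear_haar (L1 L2 : (borel G -> \bar R) -> \bar R) :
  sigma_linear L1 -> sigma_linear L2 ->
  (forall n A, bmeasurable A -> A `<=` K n.+1 ->
    L1 (fun x => (\1_A x)%:E) = L2 (fun x => (\1_A x)%:E)) ->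
  forall f, nnmeasurable f -> L1 f = L2 f.
Proof.
move=> s1 s2 e; apply: eq_sigma_linear => // A mA.
pose F n (x : borel G) := (\1_(A `&` K n.+1) x)%:E : \bar R.
have mAK n : bmeasurable (A `&` K n.+1) by apply: measurableI => //;
    exact: (leu_measurable hK).
have nF n : nnmeasurable (F n) by exact: nnmeasurable_indic.
have ndF x : {homo F^~ x : n m / (n <= m)%N >-> n <= m}.
  move=> n m nm; rewrite lee_fin !indicE ler_nat.
  have /subsetPset AK := leu_exhaust_homo hK A nm.
  case: (boolP (x \in A `&` K n.+1)) => //; rewrite inE => /AK Ax.
  by rewrite mem_set.
have FA x : F^~ x @ \oo --> ((\1_A x)%:E : \bar R).
  have [n _ Kx] : (\bigcup_n K n.+1) x by rewrite (leu_cover hK).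
  apply: cvg_near_cst; exists n => // m /= nm.
  rewrite /F !indicE; suff -> : (x \in A `&` K m.+1) = (x \in A) by [].
  apply/idP/idP; rewrite !inE; first by case.
  by move=> Ax; split=> //; apply: (leu_le hK) Kx.
have nA := nnmeasurable_indic mA.
have h1 := sigma_linear_cvg s1 nF nA ndF FA.
have h2 := sigma_linear_cvg s2 nF nA ndF FA.
rewrite -(cvg_lim (@ereal_hausdorff R) h1) -(cvg_lim (@ereal_hausdorff R) h2).
have -> // : L1 \o F = L2 \o F by apply/funext => n; apply: (e n);
    [exact: mAK|exact: subIsetr].
Qed.

Lemma haar_integral_mull (a : G) (f : borel G -> \bar R) : measurable_fun setT f ->
  \int[mu]_y f (a * y)%g = \int[mu]_y f y.
Proof.
have nn (k : borel G -> \bar R) : measurable_fun setT k -> (forall x, 0 <= k x) ->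
    \int[mu]_y k (a * y)%g = \int[mu]_y k y.
  move=> mk k0; have mphi := @measurable_mull G a.
  rewrite -(@ge0_integral_pushforward _ _ _ _ _ _ mphi mu setT k measurableT) //.
  apply: eq_measure_integral => A mA _.
  by rewrite /pushforward -(haar_translate hmu a^-1%g mA) /translate invgK.
move=> mf; rewrite integralE [RHS]integralE.
have mfp : measurable_fun setT f^\+ by exact: measurable_funepos.
have mfn : measurable_fun setT f^\- by exact: measurable_funeneg.
rewrite -(nn _ mfp); last exact: funepos_ge0.
rewrite -(nn _ mfn); last exact: funeneg_ge0.
by congr (_ - _); apply: eq_integral => y _; rewrite ?funeposE ?funenegE.
Qed.

Lemma haar_integral_invg (f : borel G -> \bar R) : measurable_fun setT f ->
  \int[mu]_y f (y^-1)%g = \int[mu]_y f y.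
Proof.
have nn (k : borel G -> \bar R) : measurable_fun setT k -> (forall x, 0 <= k x) ->
    \int[mu]_y k (y^-1)%g = \int[mu]_y k y.
  move=> mk k0; have mphi := @measurable_invg G.
  rewrite -(@ge0_integral_pushforward _ _ _ _ _ _ mphi mu setT k measurableT) //.
  apply: eq_measure_integral => A mA _.
  exact: (haar_invs hK hmu hmu1).
move=> mf; rewrite integralE [RHS]integralE.
have mfp : measurable_fun setT f^\+ by exact: measurable_funepos.
have mfn : measurable_fun setT f^\- by exact: measurable_funeneg.
rewrite -(nn _ mfp); last exact: funepos_ge0.
rewrite -(nn _ mfn); last exact: funeneg_ge0.
by congr (_ - _); apply: eq_integral => y _; rewrite ?funeposE ?funenegE.
Qed.

Definition nnconv f g (x : borel G) := \int[mu]_y (f y * g (y^-1 * x)%g).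

Lemma nnmeasurable_nnconv f g : nnmeasurable f -> nnmeasurable g ->
    nnmeasurable (nnconv f g).
Proof.
move=> nf ng; have [mf f0] := nf; have [mg g0] := ng; split; last first.
  by move=> x; apply: integral_ge0 => y _; rewrite mule_ge0.
rewrite /nnconv; apply: (measurable_conv_integral hK hmu (Phi := fun z : borel G *
    borel G => f z.1 * g z.2)).
  by apply: emeasurable_funM;
      [exact: measurableT_comp measurable_fst|exact: measurableT_comp measurable_snd].
by move=> z; rewrite mule_ge0.
Qed.

Lemma nnmeasurable_translate_integral h g : nnmeasurable h -> nnmeasurable g ->
  nnmeasurable (fun y : borel G => \int[mu]_x (h x * g (y^-1 * x)%g)).
Proof.
move=> nh ng.
have -> : (fun y : borel G =>
    \int[mu]_x (h x * g (y^-1 * x)%g)) = nnconv h (g \o (fun x : borel G =>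
        (x^-1)%g : borel G)).
  by apply/funext => y; apply: eq_integral => x _; rewrite /= invgM invgK.
apply: nnmeasurable_nnconv => //; apply: nnmeasurable_comp => //.
exact: measurable_invg.
Qed.

(** Both sides are sigma-linear in h, in f and in g, and for indicators of bounded
    sets they are the two sides of [overlap_invs]. *)
Lemma haar_fubini h f g : nnmeasurable h -> nnmeasurable f -> nnmeasurable g ->
  \int[mu]_x (h x * \int[mu]_y (f y * g (y^-1 * x)%g)) =
  \int[mu]_y (f y * \int[mu]_x (h x * g (y^-1 * x)%g)).
Proof.
move=> nh nf ng.
have slM (k : borel G -> \bar R) : nnmeasurable k ->
    sigma_linear (fun f : borel G -> \bar R => \int[mu]_y (k y * f y)).
  move=> nk; apply: (sigma_linear_comp mu (L := fun (y : borel G) (f : borel G ->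
      \bar R) => f y)) => // y.
  exact: sigma_linear_eval.
have slMr (k : borel G -> \bar R) : nnmeasurable k ->
    sigma_linear (fun f : borel G -> \bar R => \int[mu]_y (f y * k y)).
  move=> /slM; congr sigma_linear; apply/funext => l.
  by apply: eq_integral => y _; rewrite muleC.
have ntr (k : borel G -> \bar R) (x : G) : nnmeasurable k ->
    nnmeasurable (fun y : borel G => k (y^-1 * x)%g).
  by move=> nk; exact: (nnmeasurable_comp (measurable_invg_mul x) nk).
have ntl (k : borel G -> \bar R) (x : G) : nnmeasurable k ->
    nnmeasurable (fun y : borel G => k (x * y)%g).
  by move=> nk; exact: (nnmeasurable_comp (measurable_mull x) nk).
move: h nh; apply: eq_sigma_linear_haar.
- by apply: slMr; exact: nnmeasurable_nnconv.
- apply: sigma_linear_comp => // [y|h nh]; first by apply: slMr; exact: ntl.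
  exact: nnmeasurable_translate_integral.
move=> n D mD DK; have nD := nnmeasurable_indic mD.
move: f nf; apply: eq_sigma_linear_haar.
- apply: sigma_linear_comp => // [x|f nf]; first by apply: slMr; exact: ntr.
  exact: nnmeasurable_nnconv.
- by apply: slMr; exact: nnmeasurable_translate_integral.
move=> m B mB BK; have nB := nnmeasurable_indic mB.
move: g ng; apply: eq_sigma_linear_haar.
- apply: sigma_linear_comp => // [x|g ng]; last exact: nnmeasurable_nnconv.
  apply: (sigma_linear_comp mu (L := fun (y : borel G) (f : borel G ->
      \bar R) => f (y^-1 * x)%g)) => // [y|g ng]; last exact: ntr.
  exact: sigma_linear_eval.
- apply: sigma_linear_comp => // [x|g ng]; last exact: nnmeasurable_translate_integral.
  apply: (sigma_linear_comp mu (L := fun (y : borel G) (f : borel G ->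
      \bar R) => f (x^-1 * y)%g)) => // [y|g ng]; last exact: ntl.
  exact: sigma_linear_eval.
move=> k A mA AK.
have E D' B' A' : bmeasurable D' -> bmeasurable B' -> bmeasurable A' ->
    \int[mu]_y ((\1_D' y)%:E * \int[mu]_x ((\1_B' x)%:E * (\1_(translate A' y)
        x)%:E)) = overlap mu D' B' A'.
  move=> mD' mB' mA'; rewrite /overlap [RHS]integral_mkcond.
  apply: eq_integral => y _; rewrite patchE indicE.
  case: ifPn => _; last by rewrite mul0e.
  rewrite mul1e -(setIT (_ `&` _)) -integral_indic //;
      last by apply: measurableI => //; exact: measurable_translate.
  by apply: eq_integral => x _; rewrite indicI EFinM.
transitivity (overlap mu D B (invs A)).
  apply: etrans (E _ _ _ mD mB (measurable_invs mA)).
  apply: eq_integral => x _; congr (_ * _); apply: eq_integral => y _; congr (_ * _).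
  rewrite !indicE; suff -> : (y^-1 * x \in A)%g = (y \in translate (invs A) x) by [].
  by apply/idP/idP; rewrite !inE; [move=> h; exact/translate_invs|move/translate_invs].
apply: (etrans (overlap_invs hK hmu hmu1 mA AK mD DK mB BK)).
by apply: etrans (esym (E _ _ _ mB mD mA)) _.
Qed.

(** After the substitution u = y z both sides are iterated integrals of
    f y * g (y^-1 u) * h (u^-1 x), in the two possible orders. *)
Lemma nnconvA f g h : nnmeasurable f -> nnmeasurable g -> nnmeasurable h ->
  nnconv f (nnconv g h) =1 nnconv (nnconv f g) h.
Proof.
move=> nf ng nh x; rewrite /nnconv.
pose h' (u : borel G) := h (u^-1 * x)%g.
have nh' : nnmeasurable h' by exact: (nnmeasurable_comp (measurable_invg_mul x) nh).
transitivity (\int[mu]_u (h' u * nnconv f g u)); last first.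
  by apply: eq_integral => u _; rewrite muleC.
rewrite haar_fubini //; apply: eq_integral => y _; congr (_ * _).
pose k (u : borel G) := h' u * g (y^-1 * u)%g.
have mk : measurable_fun setT k.
  by have [] := nnmeasurableM nh' (nnmeasurable_comp (measurable_mull y^-1%g) ng).
rewrite -[RHS](haar_integral_mull y mk); apply: eq_integral => z _.
by rewrite /k /h' mulKg muleC invgM mulgA.
Qed.

Lemma integral_nnconv f g : nnmeasurable f -> nnmeasurable g ->
  \int[mu]_x nnconv f g x = (\int[mu]_x f x) * (\int[mu]_x g x).
Proof.
move=> nf ng; have [mf f0] := nf; have [mg g0] := ng.
have n1 : nnmeasurable (cst 1 : borel G -> \bar R) by split => //;
    exact: measurable_cst.
transitivity (\int[mu]_x (cst 1 x * nnconv f g x)).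
  by apply: eq_integral => x _; rewrite mul1e.
rewrite haar_fubini // muleC -ge0_integralZl //; last exact: integral_ge0.
apply: eq_integral => y _; rewrite muleC; congr (_ * _).
rewrite -[RHS](haar_integral_mull y^-1%g mg).
by apply: eq_integral => x _; rewrite mul1e.
Qed.

End haar_integral.

(** * The weighted space of p-integrable functions *)

Section complex_norm.
Variable R : realType.
Implicit Types (x y : R[i]).

Lemma normc_sqrtE x : normc x = Num.sqrt (Re x ^+ 2 + Im x ^+ 2).
Proof. by case: x. Qed.

Lemma normc_ge0 x : 0 <= normc x.
Proof. by rewrite normc_sqrtE sqrtr_ge0. Qed.

Lemma ler_normc_Re x : `|Re x| <= normc x.
Proof. by rewrite normc_sqrtE -sqrtr_sqr ler_wsqrtr // lerDl sqr_ge0. Qed.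

Lemma ler_normc_Im x : `|Im x| <= normc x.
Proof. by rewrite normc_sqrtE -sqrtr_sqr ler_wsqrtr // lerDr sqr_ge0. Qed.

Lemma normc_real (r : R) : normc r%:C = `|r|.
Proof. by rewrite normc_sqrtE /= expr0n /= addr0 sqrtr_sqr. Qed.

Lemma normc_ReIm_le x : normc x <= `|Re x| + `|Im x|.
Proof.
have -> : x = (Re x)%:C + (0 +i* Im x)%C by case: x => a b; apply/eqP;
    rewrite eq_complex /= addr0 add0r !eqxx.
apply: (le_trans (le_normcD _ _)); rewrite normc_real /= addr0 add0r.
by rewrite lerD // expr0n /= add0r sqrtr_sqr.
Qed.

Lemma normcN_eq x : normc (- x) = normc x.
Proof. by case: x => a b /=; rewrite !sqrrN. Qed.

Lemma normc_conj x : normc (x^*)%C = normc x.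
Proof. by case: x => a b /=; rewrite sqrrN. Qed.

Lemma Re_mul x y : Re (x * y) = Re x * Re y - Im x * Im y.
Proof. by case: x; case: y. Qed.

Lemma Im_mul x y : Im (x * y) = Re x * Im y + Im x * Re y.
Proof. by case: x; case: y. Qed.

Lemma Re_add x y : Re (x + y) = Re x + Re y.
Proof. by case: x; case: y. Qed.

Lemma Im_add x y : Im (x + y) = Im x + Im y.
Proof. by case: x; case: y. Qed.

End complex_norm.

Section complex_measurable.
Variables (R : realType) (G : topologicalGroupType).
Implicit Types f g : G -> R[i].

Lemma measurable_normc f : complex_measurable f ->
  measurable_fun [set: borel G] (fun x : borel G => normc (f x)).
Proof.
move=> [mr mi].
apply: (eq_measurable_fun (fun x : borel G =>
    Num.sqrt (Re (f x) ^+ 2 + Im (f x) ^+ 2))).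
  by move=> x _; rewrite normc_sqrtE.
apply: (@measurableT_comp _ _ _ _ _ _ (@Num.sqrt R)).
  by apply: continuous_measurable_fun; exact: sqrt_continuous.
by apply: measurable_funD; exact: measurable_funX.
Qed.

Lemma complex_measurable0 : complex_measurable (0 : G -> R[i]).
Proof. by split; exact: measurable_cst. Qed.

Lemma complex_measurable_linear (a : R[i]) f g :
  complex_measurable f -> complex_measurable g -> complex_measurable (a *: f + g).
Proof.
move=> [mfr mfi] [mgr mgi]; split.
  apply: (eq_measurable_fun (fun x : borel G =>
      (Re a * Re (f x) - Im a * Im (f x)) + Re (g x))).
    by move=> x _; rewrite -Re_mul -Re_add.
  by apply: measurable_funD => //; apply: measurable_funB;
      apply: measurable_funM => //; exact: measurable_cst.
apply: (eq_measurable_fun (fun x : borel G =>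
    (Re a * Im (f x) + Im a * Re (f x)) + Im (g x))).
  by move=> x _; rewrite -Im_mul -Im_add.
by apply: measurable_funD => //; apply: measurable_funD;
    apply: measurable_funM => //; exact: measurable_cst.
Qed.

Lemma complex_measurableB f g :
  complex_measurable f -> complex_measurable g -> complex_measurable (f - g).
Proof.
move=> mf mg; rewrite addrC -[- g]scaleN1r; exact: complex_measurable_linear.
Qed.

Lemma complex_measurable_weighted (W : G -> R) f :
  measurable_fun [set: borel G] (W : borel G -> R) ->
  complex_measurable f -> complex_measurable (weighted W f).
Proof.
move=> mW [mr mi]; split.
  apply: (eq_measurable_fun (fun x : borel G => Re (f x) * W x)).
    by move=> x _; rewrite Re_mul /= mulr0 subr0.
  exact: measurable_funM.
apply: (eq_measurable_fun (fun x : borel G => Im (f x) * W x)).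
  by move=> x _; rewrite Im_mul /= mulr0 add0r.
exact: measurable_funM.
Qed.

End complex_measurable.

Section weighted_Lp.
Variables (R : realType) (G : topologicalGroupType).
Variable mu : {measure set (borel G) -> \bar R}.
Variables (p : R) (W : G -> R).
Hypothesis hp : 1 <= p.
Hypothesis mW : measurable_fun [set: borel G] (W : borel G -> R).
Hypothesis W1 : forall x, 1 <= W x.
Implicit Types f g : G -> R[i].
Local Notation D := (Lpw mu p W).
Local Notation nrm := (Lpw_norm mu p W).

Definition wmod f (x : borel G) : R := normc (f x) * W x.
(** The p-th power of the norm of L^p(G, W), in [0, +oo]. *)
Definition wpow f : \bar R := (\int[mu]_x (wmod f x `^ p)%:E)%E.

Let p0 : 0 < p. Proof. exact: lt_le_trans hp. Qed.
Let pn0 : p != 0. Proof. by rewrite gt_eqF. Qed.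
Let W0 x : 0 <= W x. Proof. exact: le_trans (W1 x). Qed.

Lemma wmod_ge0 f x : 0 <= wmod f x.
Proof. by rewrite mulr_ge0 ?normc_ge0. Qed.

Lemma normc_weighted f x : normc (weighted W f x) = wmod f x.
Proof. by rewrite /weighted Normc.normcM normc_real ger0_norm. Qed.

Lemma normc_le_wmod f x : normc (f x) <= wmod f x.
Proof. by rewrite ler_peMr ?normc_ge0. Qed.

Lemma measurable_wmod f : complex_measurable f ->
  measurable_fun [set: borel G] (wmod f).
Proof. by move=> mf; apply: measurable_funM => //; exact: measurable_normc. Qed.

Lemma measurable_wmodX f : complex_measurable f ->
  measurable_fun [set: borel G] (fun x => (wmod f x `^ p)%:E).
Proof.
move=> mf; apply/measurable_EFinP; apply: (measurableT_comp (measurable_powR _)).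
exact: measurable_wmod.
Qed.

Lemma Lp_norm_weightedE f : Lp_norm mu p (weighted W f) = Lnorm mu p%:E (EFin \o wmod
    f).
Proof.
rewrite /Lp_norm; congr Lnorm.
by apply/funext => x /=; rewrite normc_weighted.
Qed.

Lemma Lp_norm_weighted_pow f : (Lp_norm mu p (weighted W f) `^ p = wpow f)%E.
Proof.
rewrite Lp_norm_weightedE (@poweR_Lnorm _ _ _ mu _ _ pn0); apply: eq_integral => x _.
by rewrite /= ger0_norm ?wmod_ge0 // poweR_EFin.
Qed.

Lemma Lp_norm_wpowE f : (Lp_norm mu p (weighted W f) = wpow f `^ p^-1)%E.
Proof.
rewrite -Lp_norm_weighted_pow -poweRrM mulfV // poweRe1 //; exact: Lnorm_ge0.
Qed.

Lemma wpow_ge0 f : (0 <= wpow f)%E.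
Proof. by apply: integral_ge0 => x _; rewrite lee_fin powR_ge0. Qed.

Lemma le_wpow f g : complex_measurable f -> complex_measurable g ->
  (forall x, wmod f x <= wmod g x) -> (wpow f <= wpow g)%E.
Proof.
move=> mf mg fg; apply: ge0_le_integral => //.
- by move=> x _; rewrite lee_fin powR_ge0.
- exact: measurable_wmodX.
- exact: measurable_wmodX.
- by move=> x _; rewrite lee_fin ge0_ler_powR ?nnegrE ?wmod_ge0 // ltW.
Qed.

(** As W >= 1, integrability of (|f| W)^p implies that of |f|^p. *)
Lemma LpwP f : D f <-> complex_measurable f /\ (wpow f < +oo)%E.
Proof.
have pV0 : 0 < p^-1 by rewrite invr_gt0.
split=> [[[mf _] [_]]|[mf ff]].
  by move=> h; split=> //; rewrite -Lp_norm_weighted_pow poweR_lty.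
have mwf := complex_measurable_weighted mW mf.
split; split=> //; last by rewrite Lp_norm_wpowE poweR_lty.
have h : (Lp_norm mu p f `^ p <= wpow f)%E.
  rewrite /Lp_norm (@poweR_Lnorm _ _ _ mu _ _ pn0); apply: ge0_le_integral => //.
  - by move=> x _; rewrite poweR_ge0.
  - apply: (eq_measurable_fun (fun x : borel G => (normc (f x) `^ p)%:E)).
      by move=> x _; rewrite /= ger0_norm ?normc_ge0 // poweR_EFin.
    apply/measurable_EFinP; apply: (measurableT_comp (measurable_powR _)).
    exact: measurable_normc.
  - exact: measurable_wmodX.
  - move=> x _; rewrite /= ger0_norm ?normc_ge0 // ?poweR_EFin lee_fin.
    by rewrite ge0_ler_powR ?nnegrE ?wmod_ge0 ?normc_ge0 ?normc_le_wmod // ltW.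
have N0 : (0 <= Lp_norm mu p f)%E by exact: Lnorm_ge0.
rewrite -(@poweRe1 _ (Lp_norm mu p f)) // -(mulfV pn0) poweRrM.
by rewrite poweR_lty // (le_lt_trans h).
Qed.

Lemma Lpw_normE f : D f -> ((nrm f)%:E = Lp_norm mu p (weighted W f))%E.
Proof.
move=> [_ [_ h]]; rewrite /Lpw_norm fineK // ge0_fin_numE //; exact: Lnorm_ge0.
Qed.

Lemma Lpw_norm_pow f : D f -> ((nrm f `^ p)%:E = wpow f)%E.
Proof. by move=> Df; rewrite -Lp_norm_weighted_pow -Lpw_normE // poweR_EFin. Qed.

Lemma Lpw_norm_ge0 f : 0 <= nrm f.
Proof. by apply: fine_ge0; exact: Lnorm_ge0. Qed.

Lemma wpow_fin_num f : D f -> wpow f \is a fin_num.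
Proof. by move=> /LpwP[_ h]; rewrite ge0_fin_numE ?wpow_ge0. Qed.

Lemma Lpw_norm_le f (b : R) : D f -> 0 <= b -> (wpow f <= (b `^ p)%:E)%E -> nrm f <= b.
Proof.
move=> Df b0; rewrite -Lpw_norm_pow // lee_fin => h.
have := @ge0_ler_powR _ p^-1 _ (nrm f `^ p) (b `^ p).
rewrite !nnegrE !powR_ge0 -!powRrM mulfV // !powRr1 ?Lpw_norm_ge0 //; apply => //.
by rewrite invr_ge0 ltW.
Qed.

Lemma Lpw_le f g : complex_measurable f -> (forall x, normc (f x) <= normc (g x)) ->
  D g -> D f.
Proof.
move=> mf fg /LpwP[mg gf]; apply/LpwP; split; first exact: mf.
by apply: le_lt_trans gf; apply: le_wpow => // x; rewrite ler_wpM2r.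
Qed.

Lemma Lpw_0 : D 0.
Proof.
apply/LpwP; split; first exact: complex_measurable0.
rewrite /wpow (eq_integral (cst 0%E)) ?integral0 // => x _.
by rewrite /wmod Normc.normc0 mul0r powR0.
Qed.

Lemma Lp_norm_weightedD f g : complex_measurable f -> complex_measurable g ->
  (Lp_norm mu p (weighted W (f + g)%R) <= Lp_norm mu p (weighted W f) + Lp_norm mu p
      (weighted W g))%E.
Proof.
move=> mf mg; rewrite !Lp_norm_weightedE.
apply: (@le_trans _ _ (Lnorm mu p%:E (EFin \o (wmod f \+ wmod g)))); last first.
  by apply: minkowski_EFin => //; exact: measurable_wmod.
have mfg : complex_measurable (f + g).
  by rewrite -[f]scale1r; exact: complex_measurable_linear.
rewrite unlock; apply: gt0_ler_poweR.
- by rewrite invr_ge0 ltW.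
- by rewrite in_itv /= leey andbT; apply: integral_ge0 => x _; rewrite lee_fin powR_ge0.
- by rewrite in_itv /= leey andbT; apply: integral_ge0 => x _; rewrite lee_fin powR_ge0.
apply: ge0_le_integral => //.
- by move=> x _; rewrite poweR_ge0.
- apply: (eq_measurable_fun (fun x => (wmod (f + g) x `^ p)%:E));
    last exact: measurable_wmodX.
  by move=> x _ /=; rewrite ger0_norm ?wmod_ge0 // poweR_EFin.
- apply: (eq_measurable_fun (fun x => ((wmod f x + wmod g x) `^ p)%:E)).
    by move=> x _ /=; rewrite ger0_norm ?addr_ge0 ?wmod_ge0 // poweR_EFin.
  apply/measurable_EFinP; apply: (measurableT_comp (measurable_powR _)).
  by apply: measurable_funD; exact: measurable_wmod.
- move=> x _ /=; rewrite !ger0_norm ?addr_ge0 ?wmod_ge0 // ?poweR_EFin lee_fin.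
  rewrite ge0_ler_powR ?nnegrE ?addr_ge0 ?wmod_ge0 //; first exact: ltW.
  by rewrite -mulrDl ler_wpM2r // le_normcD.
Qed.

Lemma wpowZ (a : R[i]) f : complex_measurable f ->
  wpow (a *: f) = ((normc a `^ p)%:E * wpow f)%E.
Proof.
move=> mf; rewrite -ge0_integralZl //.
- by apply: eq_integral => x _;
    rewrite /wmod Normc.normcM -mulrA powRM ?normc_ge0 ?wmod_ge0 // EFinM.
- exact: measurable_wmodX.
- by move=> x _; rewrite lee_fin powR_ge0.
- by rewrite lee_fin powR_ge0.
Qed.

Lemma LpwZ (a : R[i]) f : D f -> D (a *: f).
Proof.
move=> /LpwP[mf ff]; apply/LpwP; split.
  by rewrite -[_ *: _]addr0; apply: complex_measurable_linear => //;
      exact: complex_measurable0.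
by rewrite wpowZ // lte_mul_pinfty ?lee_fin ?powR_ge0.
Qed.

Lemma LpwD f g : D f -> D g -> D (f + g).
Proof.
move=> Df Dg; have [mf _] := (LpwP f).1 Df; have [mg _] := (LpwP g).1 Dg.
have mfg : complex_measurable (f + g).
  by rewrite -[f]scale1r; exact: complex_measurable_linear.
apply/LpwP; split=> //; rewrite -Lp_norm_weighted_pow poweR_lty //.
apply: (le_lt_trans (Lp_norm_weightedD mf mg)).
by rewrite -!Lpw_normE // -EFinD ltry.
Qed.

Lemma LpwB f g : D f -> D g -> D (f - g).
Proof. by move=> Df Dg; apply: LpwD => //; rewrite -scaleN1r; exact: LpwZ. Qed.

Lemma Lpw_normD f g : D f -> D g -> nrm (f + g) <= nrm f + nrm g.
Proof.
move=> Df Dg; have [mf _] := (LpwP f).1 Df; have [mg _] := (LpwP g).1 Dg.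
rewrite -lee_fin EFinD (Lpw_normE (LpwD Df Dg)) (Lpw_normE Df) (Lpw_normE Dg).
exact: Lp_norm_weightedD.
Qed.

Lemma Lpw_normZ (a : R[i]) f : D f -> nrm (a *: f) = normc a * nrm f.
Proof.
move=> Df; have [mf _] := (LpwP f).1 Df; apply: EFin_inj.
rewrite EFinM (Lpw_normE (LpwZ a Df)) (Lpw_normE Df).
rewrite !Lp_norm_wpowE wpowZ // poweRM ?wpow_ge0 ?lee_fin ?powR_ge0 //.
by rewrite poweR_EFin -powRrM mulfV // powRr1 ?normc_ge0.
Qed.

Lemma Lpw_eqP f g : D f -> D g ->
  ae_eq mu [set: borel G] (f : borel G -> _) g <-> nrm (f - g) = 0.
Proof.
move=> Df Dg; have Dfg := LpwB Df Dg; have [mfg _] := (LpwP _).1 Dfg.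
have mm := measurable_wmod mfg.
split=> [h|h].
  apply: EFin_inj; rewrite Lpw_normE // Lp_norm_wpowE.
  suff -> : wpow (f - g) = 0%E by rewrite poweR0r // invr_eq0.
  rewrite /wpow (ge0_ae_eq_integral (g := cst 0%E)) ?integral0 //.
  - exact: measurable_wmodX.
  - by move=> x _; rewrite lee_fin powR_ge0.
  - apply: filterS h => x h _; rewrite /wmod.
    have -> : (f - g) x = 0 by rewrite [LHS](_ : _ = f x - g x) // (h I) subrr.
    by rewrite Normc.normc0 mul0r powR0.
have : Lnorm mu p%:E (EFin \o wmod (f - g)) = 0%E by rewrite -Lp_norm_weightedE
    -Lpw_normE // h.
have mm' : measurable_fun [set: borel G] (EFin \o wmod (f - g)) by
    exact/measurable_EFinP.
have p0' : (0 < p%:E)%E by rewrite lte_fin.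
move=> /(Lnorm_eq0_eq0 mm' p0') h0.
apply: filterS h0 => x /= h0 _; have {h0} : wmod (f - g) x = 0 by apply: EFin_inj;
    rewrite h0.
move=> /eqP; rewrite mulf_eq0 => /orP[/eqP/Normc.eq0_normc h0|]; last first.
  by rewrite gt_eqF // (lt_le_trans _ (W1 x)).
by apply/eqP; rewrite -subr_eq0; apply/eqP.
Qed.

End weighted_Lp.

(** * Completeness *)

Section geometric.
Variable R : realType.

Lemma ex_half_expn_lt (e c : R) : 0 < e -> exists k, c * 2^-1 ^+ k < e.
Proof.
move=> e0; pose k := Num.bound (`|c| / e); exists k.
have h : `|c| / e < k%:R by apply: archi_boundP; rewrite divr_ge0 // ltW.
have k2 : (k%:R : R) < 2 ^+ k by rewrite -natrX ltr_nat ltn_expl.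
rewrite exprVn ltr_pdivrMr ?exprn_gt0 //.
apply: (le_lt_trans (ler_norm c)); rewrite -ltr_pdivrMl // mulrC.
exact: lt_trans k2.
Qed.

Lemma geometric_cauchy (a : nat -> R) (M : R) :
  (forall k, `|a k.+1 - a k| <= M * 2^-1 ^+ k) ->
  cvgn a /\ forall k, `|limn a - a k| <= 2 * M * 2^-1 ^+ k.
Proof.
move=> aM.
have M0 : 0 <= M by have := le_trans (normr_ge0 _) (aM 0%N); rewrite expr0 mulr1.
have h0 k j : `|a (k + j)%N - a k| <= 2 * M * 2^-1 ^+ k * (1 - 2^-1 ^+ j).
  elim: j => [|j IH]; first by rewrite addn0 subrr normr0 expr0 subrr mulr0.
  rewrite addnS -(subrKA (a (k + j)%N)); apply: (le_trans (ler_normD _ _)).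
  apply: (le_trans (lerD (aM _) IH)); rewrite exprD exprS.
  by rewrite le_eqVlt; apply/orP; left; apply/eqP; field.
have h k j : `|a (k + j)%N - a k| <= 2 * M * 2^-1 ^+ k.
  apply: (le_trans (h0 k j)); apply: ler_piMr;
      last by rewrite gerBl exprn_ge0 // invr_ge0.
  by rewrite !mulr_ge0 ?exprn_ge0 ?invr_ge0.
have ca : cvgn a.
  apply/cauchy_cvgP/cauchy_exP => e e0.
  have [k hk] := ex_half_expn_lt (2 * M) e0.
  exists (a k); exists k => // n /= kn; rewrite /ball /= distrC.
  by apply: le_lt_trans hk; rewrite -(subnKC kn); exact: h.
split=> // k.
have c1 : (fun j => `|a j - a k|) @ \oo --> `|limn a - a k|.
  by apply: cvg_norm; apply: cvgB => //; exact: cvg_cst.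
rewrite -(cvg_lim (@Rhausdorff R) c1); apply: limr_le; first by apply/cvg_ex;
    exists `|limn a - a k|; exact: c1.
by exists k => // n /= kn; rewrite -(subnKC kn); exact: h.
Qed.
End geometric.

Section completeness.
Variables (R : realType) (G : topologicalGroupType).
Variable mu : {measure set (borel G) -> \bar R}.
Variables (p : R) (W : G -> R).
Hypothesis hp : 1 <= p.
Hypothesis mW : measurable_fun [set: borel G] (W : borel G -> R).
Hypothesis W1 : forall x, 1 <= W x.
Local Notation D := (Lpw mu p W).
Local Notation nrm := (Lpw_norm mu p W).
Local Notation wabs := (wmod W).
Local Notation wint := (wpow mu p W).
Local Notation h := (2^-1 : R).

Let p0 : 0 < p. Proof. exact: lt_le_trans hp. Qed.
Let pn0 : p != 0. Proof. by rewrite gt_eqF. Qed.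
Let hX0 k : 0 < h ^+ k. Proof. by rewrite exprn_gt0 // invr_gt0. Qed.

(** Let d k = v k.+1 - v k. The functions (2^k |d k| W)^p have integrals at most
    2^-k, so that their sum S is integrable, hence finite almost everywhere. Where it
    is finite, |d k| W <= S^(1/p) 2^-k; this gives the pointwise limit f as well as a
    bound for |f - v k| W by a small multiple of S^(1/p). Elsewhere f is 0. *)
Lemma Lpw_fast_cvg (v : nat -> G -> R[i]) : (forall k, D (v k)) ->
  (forall k, nrm (v k.+1 - v k) <= h ^+ k * h ^+ k) ->
  exists2 f, D f & forall k, nrm (v k - f) <= 8 * h ^+ k.
Proof.
move=> Dv hv.
have mv k : complex_measurable (v k) by have [] := (LpwP mu hp mW W1 _).1 (Dv k).
pose d k := v k.+1 - v k.
have Dd k : D (d k) by exact: (LpwB hp mW W1).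
have md k : complex_measurable (d k) by exact: complex_measurableB.
pose H k (x : borel G) : \bar R := ((2 ^+ k * wabs (d k) x) `^ p)%:E.
have H0 k x : (0 <= H k x)%E by rewrite lee_fin powR_ge0.
have mH k : measurable_fun setT (H k).
  apply/measurable_EFinP; apply: (measurableT_comp (measurable_powR _)).
  by apply: measurable_funM; [exact: measurable_cst|exact: measurable_wmod].
have iH k : (\int[mu]_x H k x <= (h ^+ k)%:E)%E.
  have -> : (\int[mu]_x H k x = ((2 ^+ k) `^ p)%:E * wint (d k))%E.
    rewrite -ge0_integralZl //.
    - apply: eq_integral => x _; rewrite /H powRM ?exprn_ge0 ?wmod_ge0 // EFinM //.
    - exact: measurable_wmodX.
    - by move=> x _; rewrite lee_fin powR_ge0.
  rewrite -(Lpw_norm_pow hp W1 (Dd k)) -EFinM -powRM ?exprn_ge0 ?Lpw_norm_ge0 //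
      lee_fin.
  have le1 : 2 ^+ k * nrm (d k) <= h ^+ k.
    have := ler_wpM2l (exprn_ge0 k (ler0n R 2)) (hv k).
    by rewrite mulrA -exprMn mulfV // expr1n mul1r.
  apply: (@le_trans _ _ ((h ^+ k) `^ p)).
    by rewrite ge0_ler_powR ?nnegrE ?mulr_ge0 ?exprn_ge0 ?Lpw_norm_ge0 ?invr_ge0 // ltW.
  by apply: ge1r_powR => //; rewrite hX0 exprn_ile1 // ?invr_ge0 // invf_le1 // ler1n.
pose S (x : borel G) : \bar R := (\sum_(k <oo) H k x)%E.
have S0 x : (0 <= S x)%E by apply: nneseries_ge0.
have mS : measurable_fun setT S.
  by apply: ge0_emeasurable_sum.
have iS : (\int[mu]_x S x <= 2%:E)%E.
  rewrite integral_nneseries //; apply: lime_le.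
    by apply: is_cvg_nneseries => k _ _; exact: integral_ge0.
  apply: nearW => n; apply: (@le_trans _ _ (\sum_(0 <= k < n) (h ^+ k)%:E)%E).
    by apply: lee_sum => k _; exact: iH.
  suff -> : (\sum_(0 <= k < n) (h ^+ k)%:E = (2 - 2 * h ^+ n)%:E)%E.
    by rewrite lee_fin gerBl mulr_ge0 // ltW.
  elim: n => [|n IH]; first by rewrite big_nil expr0 mulr1 subrr.
  by rewrite big_nat_recr //= IH -EFinD exprS; congr EFin; field.
have aeS : {ae mu, forall x, setT x -> S x \is a fin_num}.
  apply: integrable_ae => //; apply/integrableP; split=> //.
  rewrite (eq_integral S) => [|x _]; last by rewrite gee0_abs.
  by apply: (le_lt_trans iS); rewrite ltry.
pose E : set (borel G) := [set x | S x \is a fin_num].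
have mE : measurable E by rewrite -(setTI E); exact: emeasurable_fin_num.
pose M x := fine (S x) `^ p^-1.
have M0 x : 0 <= M x by exact: powR_ge0.
have dM x k : E x -> normc (d k x) <= M x / W x * h ^+ k.
  move=> Ex; rewrite mulrAC ler_pdivlMr ?(lt_le_trans _ (W1 x)) //.
  rewrite -/(wabs (d k) x) exprVn ler_pdivlMr ?exprn_gt0 // mulrC.
  have HS : (2 ^+ k * wabs (d k) x) `^ p <= fine (S x).
    rewrite -lee_fin fineK // -/(H k x).
    apply: le_trans (nneseries_lim_ge k.+1 _) => //.
    by rewrite big_nat_recr //= leeDr // sume_ge0.
  have t0 : 0 <= 2 ^+ k * wabs (d k) x by rewrite mulr_ge0 ?exprn_ge0 ?wmod_ge0.
  have -> : 2 ^+ k * wabs (d k) x = ((2 ^+ k * wabs (d k) x) `^ p) `^ p^-1 by rewrite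
      -powRrM mulfV // powRr1.
  by apply: ge0_ler_powR;
      [rewrite invr_ge0 ltW|rewrite nnegrE powR_ge0|rewrite nnegrE fine_ge0|exact: HS].
pose ar k (x : borel G) : R := if x \in E then Re (v k x) else 0.
pose ai k (x : borel G) : R := if x \in E then Im (v k x) else 0.
have arM x k : `|ar k.+1 x - ar k x| <= (if x \in E then M x / W x else 0) * h ^+ k.
  rewrite /ar; case: ifPn => [|_]; last by rewrite subrr normr0 mul0r.
  rewrite inE => Ex; apply: le_trans (dM x k Ex); apply: le_trans (ler_normc_Re _).
  by rewrite [d k x](_ : _ = v k.+1 x + - v k x) // Re_add; case: (v k x).
have aiM x k : `|ai k.+1 x - ai k x| <= (if x \in E then M x / W x else 0) * h ^+ k.
  rewrite /ai; case: ifPn => [|_]; last by rewrite subrr normr0 mul0r.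
  rewrite inE => Ex; apply: le_trans (dM x k Ex); apply: le_trans (ler_normc_Im _).
  by rewrite [d k x](_ : _ = v k.+1 x + - v k x) // Im_add; case: (v k x).
pose f (x : G) : R[i] := (limn (ar^~ x) +i* limn (ai^~ x))%C.
have mlim (a : nat -> borel G -> R) : (forall k, measurable_fun setT (a k)) ->
   (forall x, cvgn (a^~ x)) -> measurable_fun setT (fun x => limn (a^~ x)).
  by move=> ma ca; apply: (measurable_fun_cvg ma) => x _; exact: ca.
have mif (g : borel G -> R) : measurable_fun setT g ->
    measurable_fun setT (fun x : borel G => if x \in E then g x else 0).
  move=> mg; apply: (eq_measurable_fun (fun x : borel G => g x * \1_E x)).
    by move=> x _; rewrite indicE; case: (x \in E); rewrite ?mulr1 ?mulr0.
  by apply: measurable_funM => //; exact: measurable_indic.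
have mf : complex_measurable f.
  split; apply: mlim.
  - by move=> k; apply: mif; have [] := mv k.
  - by move=> x; have [] := geometric_cauchy (arM x).
  - by move=> k; apply: mif; have [] := mv k.
  - by move=> x; have [] := geometric_cauchy (aiM x).
(* 4 is 2 for the tail of the geometric series times 2 for the two parts of f;
   the 8 below also absorbs the integral of S, as 2 <= 2^p *)
have fv k x : E x -> wabs (f - v k) x <= 4 * h ^+ k * M x.
  move=> Ex; have xE : x \in E by rewrite inE.
  have [_ /(_ k)] := geometric_cauchy (arM x);
      have [_ /(_ k)] := geometric_cauchy (aiM x).
  rewrite {2}/ar {2}/ai xE => hi hr.
  rewrite /wmod; apply: (@le_trans _ _ ((`|Re ((f - v k) x)| + `|Im ((f - v k) x)|) *
      W x)).
    by rewrite ler_wpM2r ?normc_ReIm_le // (le_trans _ (W1 x)).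
  have -> : Re ((f - v k) x) = limn (ar^~ x) - Re (v k x).
    by rewrite [(f - v k) x](_ : _ = f x + - v k x) // Re_add; case: (v k x).
  have -> : Im ((f - v k) x) = limn (ai^~ x) - Im (v k x).
    by rewrite [(f - v k) x](_ : _ = f x + - v k x) // Im_add; case: (v k x).
  have Wx : 0 < W x by exact: lt_le_trans (W1 x).
  rewrite -ler_pdivlMr //; apply: (le_trans (lerD hr hi)).
  by rewrite le_eqVlt; apply/orP; left; apply/eqP; field; rewrite gt_eqF.
have mfv k : complex_measurable (f - v k) by exact: complex_measurableB.
have wfv k : (wint (f - v k)%R <= ((8 * h ^+ k) `^ p)%:E)%E.
  apply: (@le_trans _ _ (\int[mu]_x (((4 * h ^+ k) `^ p)%:E * S x))%E).
    apply: ae_ge0_le_integral => //.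
    - by move=> x _; rewrite lee_fin powR_ge0.
    - exact: measurable_wmodX.
    - by move=> x _; rewrite mule_ge0 // lee_fin powR_ge0.
    - by apply: emeasurable_funM => //; exact: measurable_cst.
    - apply: filterS aeS => x /(_ I) Sx _; rewrite -(fineK Sx) -EFinM lee_fin.
      have MS : M x `^ p = fine (S x) by rewrite /M -powRrM mulVf // powRr1 // fine_ge0.
      rewrite -MS -powRM ?mulr_ge0 ?(ltW (hX0 k)) //.
      by rewrite ge0_ler_powR ?nnegrE ?wmod_ge0 ?mulr_ge0 ?(ltW (hX0 k)) ?fv // ltW.
  rewrite ge0_integralZl ?lee_fin ?powR_ge0 //.
  apply: (@le_trans _ _ (((4 * h ^+ k) `^ p)%:E * 2%:E)%E).
    by rewrite lee_wpmul2l // lee_fin powR_ge0.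
  have -> : 8 * h ^+ k = 2 * (4 * h ^+ k) by rewrite mulrA -natrM.
  rewrite [in leRHS]powRM ?mulr_ge0 ?(ltW (hX0 k)) // -EFinM lee_fin mulrC.
  by rewrite ler_wpM2r ?powR_ge0 // le1r_powR // ler1n.
have Dfv k : D (f - v k).
  by apply/(LpwP mu hp mW W1); split=> //; apply: (le_lt_trans (wfv k)); rewrite ltry.
exists f.
  by rewrite -(subrK (v 0%N) f); exact: (LpwD hp mW W1).
move=> k; rewrite -opprB -scaleN1r (Lpw_normZ hp mW W1) //.
rewrite normcN_eq Normc.normc1 mul1r.
apply: (Lpw_norm_le hp W1 (Dfv k)) => //.
Qed.

(** A Cauchy sequence has a subsequence with increments at most 4^-k, to which
    [Lpw_fast_cvg] applies. *)
Lemma Lpw_complete (u : nat -> G -> R[i]) : (forall n, D (u n)) ->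
  (forall e : R, 0 < e -> exists N : nat, forall m n : nat,
    (N <= m)%N -> (N <= n)%N -> nrm (u m - u n) < e) ->
  exists2 f, D f & (fun n => nrm (u n - f)) @ \oo --> (0 : R).
Proof.
move=> Du cu.
have /choice[N hN] k : exists N, forall m n : nat,
    (N <= m)%N -> (N <= n)%N -> nrm (u m - u n) < h ^+ k * h ^+ k.
  by apply: cu; rewrite mulr_gt0.
(* the maximum makes the subsequence of indices nondecreasing *)
pose n_ k := (\max_(i < k.+1) N i)%N.
have nN k : (N k <= n_ k)%N by exact: (@leq_bigmax _ (fun i : 'I_k.+1 => N i) ord_max).
have nS k : (n_ k <= n_ k.+1)%N by rewrite /n_ [leqRHS]big_ord_recr /= leq_maxl.
have [|k|f Df hf] := @Lpw_fast_cvg (fun k => u (n_ k)) _ _; first by move=> k;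
    exact: Du.
  by apply: ltW; apply: hN => //; exact: leq_trans (nS k).
exists f => //; apply/cvgrPdist_lt => e e0.
have [k hk] := ex_half_expn_lt 9 e0.
exists (n_ k) => // n /= kn; rewrite sub0r normrN ger0_norm ?Lpw_norm_ge0 //.
apply: le_lt_trans hk.
rewrite -(subrKA (u (n_ k)) (u n) (- f)).
apply: (le_trans (Lpw_normD hp mW W1 _ _));
    [exact: (LpwB hp mW W1)|exact: (LpwB hp mW W1)|].
have h1 : nrm (u n - u (n_ k)) <= h ^+ k.
  apply: (@le_trans _ _ (h ^+ k * h ^+ k)).
    by apply: ltW; apply: hN => //; exact: leq_trans kn.
  by rewrite ler_piMr ?(ltW (hX0 k)) // exprn_ile1 // ?invr_ge0 // invf_le1 // ler1n.
apply: (le_trans (lerD h1 (hf k))).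
by rewrite le_eqVlt; apply/orP; left; apply/eqP; ring.
Qed.

End completeness.

(** * Weights that are functions of the level *)

Section levels.
Variables (R : realType) (G : topologicalGroupType) (K : nat -> set G).
Hypothesis hK : locally_elliptic_union K.

Lemma leu_ex (x : G) : exists n, `[< K n.+1 x >].
Proof.
have [n _ Kx] : (\bigcup_n K n.+1) x by rewrite (leu_cover hK).
by exists n; apply/asboolP.
Qed.

(** Counted from 0: [level x] is the n for which [K n.+1] is the first subgroup
    containing x. *)
Definition level (x : G) : nat := ex_minn (leu_ex x).

Lemma levelP n x : K n.+1 x <-> (level x <= n)%N.
Proof.
rewrite /level; case: ex_minnP => m /asboolP Km mmin; split=> [Kn|mn].
  by apply: mmin; apply/asboolP.
exact: (leu_le hK _ _ Km).
Qed.

Lemma level_self x : K (level x).+1 x.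
Proof. exact/levelP. Qed.

Lemma level_mul x y : (level (x * y)%g <= maxn (level x) (level y))%N.
Proof.
apply/levelP; have [_ + _] := leu_subgroup hK (ltn0Sn (maxn (level x) (level y))).
by apply; apply/levelP; rewrite ?leq_maxl ?leq_maxr.
Qed.

Lemma level_inv_le x : (level (x^-1)%g <= level x)%N.
Proof.
apply/levelP; have [_ _] := leu_subgroup hK (ltn0Sn (level x)).
by apply; apply/levelP.
Qed.

Lemma level_inv x : level (x^-1)%g = level x.
Proof.
by apply/eqP; rewrite eqn_leq level_inv_le -{1}[x]invgK level_inv_le.
Qed.

Lemma level_locally_constant x : \forall v \near (1%g : G), level (x * v)%g = level x.
Proof.
have K1 : nbhs (1%g : G) (K 1).
  apply: open_nbhs_nbhs; split; first exact: (leu_open hK).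
  by have [] := leu_subgroup hK (ltn0Sn 0).
have lv0 v : K 1 v -> level v = 0%N by move/levelP; rewrite leqn0 => /eqP.
apply: filterS K1 => v /lv0 v0; apply/eqP; rewrite eqn_leq.
have := level_mul x v; rewrite v0 maxn0 => -> /=.
by have := level_mul (x * v)%g (v^-1)%g; rewrite mulgK level_inv v0 maxn0.
Qed.

(** A function of the level is locally constant, so all its preimages are open. *)
Lemma measurable_level (phi : nat -> R) :
  measurable_fun [set: borel G] (fun x : borel G => phi (level x)).
Proof.
move=> _ Y mY; rewrite setTI; apply: open_borel_measurable.
apply: openP_near1 => x /= Yx; apply: filterS (level_locally_constant x) => v.
by rewrite /= => ->.
Qed.

Lemma compact_level (C : set G) : compact C -> exists n, forall x,
    C x -> (level x <= n)%N.
Proof.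
rewrite compact_cover => /(_ nat setT (fun n => K n.+1)).
case=> [n _|x _|s _ Cs]; first exact: (leu_open hK).
  by exists (level x) => //; exact: level_self.
exists (\max_(i <- s) i)%N => x /Cs [i /= si /levelP].
by move/leq_trans; apply; exact: leq_bigmax_seq.
Qed.

(** The level of a product is at most the larger of the two levels. Monotonicity is
    required at the levels of points only: an empty shell imposes no condition. *)
Lemma level_weight (phi : nat -> R) : (forall x, 1 <= phi (level x)) ->
  (forall x y, (level x <= level y)%N -> phi (level x) <= phi (level y)) ->
  is_weight (fun x => phi (level x)) /\ sub_additive (fun x => phi (level x)).
Proof.
move=> phi1 phile.
have phiM x y : phi (level (x * y)%g) <= phi (level x) \/ phi (level (x * y)%g) <=
    phi (level y).
  have := level_mul x y; case: (leqP (level x) (level y)) => _ h; [right|left];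
      exact: phile.
have phi0 x : 0 <= phi (level x) by exact: le_trans (phi1 x).
split; first split.
- exact: measurable_level.
- exact: phi1.
- move=> C /compact_level [n Cn]; exists (\sum_(i < n.+1) `|phi i|) => x /Cn xn.
  rewrite (bigD1 (Ordinal (xn : level x < n.+1)%N)) //=.
  by rewrite (le_trans (ler_norm _)) // lerDl sumr_ge0.
- move=> x y; have [h|h] := phiM x y; apply: (le_trans h).
    by rewrite ler_peMr.
  by rewrite ler_peMl.
- by move=> x; rewrite level_inv.
exists 1 => // x y; rewrite mul1r.
have [h|h] := phiM x y; apply: (le_trans h); first by rewrite lerDl.
by rewrite lerDr.
Qed.

Lemma indic_shell i x : (1 < i)%N ->
  \1_(K i `\` K i.-1) x = (i == (level x).+1)%:R :> R.
Proof.
case: i => [|[|i]] // _; rewrite indicE /=; congr (nat_of_bool _)%:R.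
apply/idP/eqP; rewrite inE.
  move=> [/levelP h1 /levelP /negP]; rewrite -ltnNge => h2.
  by apply/eqP; rewrite eqSS eqn_leq h2.
move=> [E]; split; apply/levelP; rewrite -E //.
by rewrite ltnn.
Qed.

(** At a given point at most one term of the series is not 0. *)
Lemma shell_series (c : nat -> R) x :
  limn (fun n => \sum_(2 <= i < n) c i * \1_(K i `\` K i.-1) x) =
  if level x is n.+1 then c n.+2 else 0.
Proof.
apply/cvg_lim => //; apply: cvg_near_cst.
exists (level x).+2 => // n /= xn; apply/eqP.
have -> : \sum_(2 <= i < n) c i * \1_(K i `\` K i.-1) x =
    \sum_(2 <= i < n | i == (level x).+1) c i.
  rewrite [RHS]big_mkcond; apply: eq_big_nat => i /andP[i1 _].
  by rewrite indic_shell //; case: eqP => _; rewrite ?mulr1 ?mulr0.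
rewrite big_nat1_eq xn andbT.
by case: (level x).
Qed.

Variables (mu : {measure set (borel G) -> \bar R}) (p : R) (w : G -> R).
Hypothesis hmu : left_haar_measure mu.
Hypothesis hmu1 : mu (K 1%N) = 1%E.
Hypothesis hp : 1 <= p.
Hypothesis hw : is_weight w.
Local Notation a := (sup_on w K).
Local Notation q := (dual_exponent p).
Local Notation shell n := (K n.+2 `\` K n.+1).
Let mK n : measurable (K n.+1 : set (borel G)) := leu_measurable hK n.
Hint Resolve mK : core.

Definition sharp_p_level n : R :=
  if n is m.+1 then (a m.+2 + m.+2%:R ^+ 2) * fine (mu (shell m)) `^ q^-1 else a 1 + 1.

Lemma sharpE x : sharp w K x = a (level x).+1.
Proof.
rewrite /sharp shell_series indicE.
have -> : (x \in K 1%N) = (level x == 0%N).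
  by rewrite -leqn0; apply/idP/idP; rewrite inE => /levelP.
by case: (level x) => [|n] /=; rewrite ?mulr1 ?mulr0 ?addr0 ?add0r.
Qed.

Lemma sharp_pE x : sharp_p mu w K p x = sharp_p_level (level x).
Proof.
rewrite /sharp_p (shell_series (fun i =>
    (a i + i%:R ^+ 2) * fine (mu (K i `\` K i.-1)) `^ q^-1)) indicE.
have -> : (x \in K 1%N) = (level x == 0%N).
  by rewrite -leqn0; apply/idP/idP; rewrite inE => /levelP.
by case: (level x) => [|n] /=; rewrite ?mulr1 ?mulr0 ?addr0 ?add0r.
Qed.

Lemma weight_le_sup n x : K n.+1 x -> w x <= a n.+1.
Proof.
move=> Kx; apply: sup_upper_bound; last by exists x.
split; first by exists (w x), x.
have [M hM] := weight_bounded_compact hw (leu_compact hK (ltn0Sn n)).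
by exists M => _ [y Ky <-]; exact: hM.
Qed.

Lemma leu_one n : K n.+1 1%g.
Proof. by have [] := leu_subgroup hK (ltn0Sn n). Qed.

Lemma sup_on_ge1 n : 1 <= a n.+1.
Proof. exact: le_trans (weight_ge1 hw 1%g) (weight_le_sup (leu_one n)). Qed.

Lemma le_sup_on m n : (m <= n)%N -> a m.+1 <= a n.+1.
Proof.
move=> mn; apply: sup_le_ub; first by exists (w 1%g), 1%g => //; exact: leu_one.
by move=> _ [x Kx <-]; apply: weight_le_sup; exact: (leu_le hK _ _ Kx).
Qed.

Lemma shell_fin n : mu (shell n) \is a fin_num.
Proof.
rewrite ge0_fin_numE //; apply: (haar_bounded_fin hK hmu (n := n.+1));
    first exact: measurableD.
exact: subDsetl.
Qed.

(** The shell of x contains the coset x (K n.+1). *)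
Lemma shell_ge1 x n : level x = n.+1 -> 1 <= fine (mu (shell n)).
Proof.
move=> xn; rewrite -lee_fin fineK ?shell_fin //.
apply: (le_trans (haar_K_ge1 hK hmu1 n)); rewrite -(haar_translate hmu x (mK n)).
apply: le_haar; [exact: measurable_translate|exact: measurableD|move=> y Ky].
have [_ MK VK] := leu_subgroup hK (ltn0Sn n).
have [_ MK' _] := leu_subgroup hK (ltn0Sn n.+1).
split.
  rewrite -(mulVKg x y); apply: MK'; first by apply/levelP; rewrite xn.
  exact: (leu_nondecreasing hK _ Ky).
move=> Kyn; have : K n.+1 x.
  rewrite -[x](mulVKg y) -[in X in K n.+1 X](invgK x) -invgM.
  by apply: MK => //; apply: VK.
by move/levelP; rewrite xn ltnn.
Qed.

Lemma dual_exponent_ge1 : 1 <= q.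
Proof.
rewrite /dual_exponent; case: eqP => [//|/eqP p1].
have p1' : 0 < p - 1 by rewrite subr_gt0 lt_neqAle eq_sym p1 hp.
by rewrite ler_pdivlMr // mul1r gerBl.
Qed.

Let q0 : 0 < q. Proof. exact: lt_le_trans dual_exponent_ge1. Qed.
Let qV0 : 0 <= q^-1. Proof. by rewrite invr_ge0 ltW. Qed.

Lemma shell_powR_ge1 x n : level x = n.+1 -> 1 <= fine (mu (shell n)) `^ q^-1.
Proof. by move=> xn; rewrite -(powRr0 (fine (mu (shell n)))) ler_powR // (shell_ge1
    xn). Qed.

Lemma sharp_weight : is_weight (sharp w K) /\ sub_additive (sharp w K).
Proof.
have -> : sharp w K = fun x => a (level x).+1 by apply/funext => x; exact: sharpE.
apply: (level_weight (phi := fun n => a n.+1)) => [x|x y]; first exact: sup_on_ge1.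
exact: le_sup_on.
Qed.

Lemma sharp_le_sharp_p x : w x <= sharp w K x <= sharp_p mu w K p x.
Proof.
rewrite sharpE sharp_pE; apply/andP; split; first exact: weight_le_sup (level_self x).
case E : (level x) => [|n] /=; first by rewrite lerDl.
apply: (@le_trans _ _ (a n.+2 + n.+2%:R ^+ 2)); first by rewrite lerDl exprn_ge0.
rewrite ler_peMr ?(shell_powR_ge1 E) // addr_ge0 ?exprn_ge0 //.
exact: le_trans (sup_on_ge1 _).
Qed.

Lemma sharp_p_ge1 x : 1 <= sharp_p mu w K p x.
Proof.
have /andP[h1 h2] := sharp_le_sharp_p x; apply: le_trans (le_trans h1 h2).
exact: weight_ge1.
Qed.

Local Notation W := (sharp_p mu w K p).

Lemma measurable_sharp_pV :
  measurable_fun [set: borel G] (fun x : borel G => ((W x)^-1 `^ q)%:E).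
Proof.
apply/measurable_EFinP.
have -> : (fun x : borel G => (W x)^-1 `^ q) = fun x =>
    (sharp_p_level (level x))^-1 `^ q.
  by apply/funext => x; rewrite sharp_pE.
exact: (measurable_level (fun n => (sharp_p_level n)^-1 `^ q)).
Qed.

(** On the shell inside [K n.+1], of measure m >= 1, the integrand is at most
    (n.+1)^-2 / m, because sharp_p is at least (n.+1)^2 m^(1/q) and q >= 1. So the
    shell contributes at most (n.+1)^-2 <= 1/n - 1/(n.+1), and the bound telescopes. *)
Lemma integral_sharp_pV_K n :
  (\int[mu]_(x in K n.+1) ((W x)^-1 `^ q)%:E <= (2 - n.+1%:R^-1)%:E)%E.
Proof.
have W0 x : 0 < W x by exact: lt_le_trans (sharp_p_ge1 x).
elim: n => [|n IH].
  apply: (@le_trans _ _ (\int[mu]_(x in K 1) (cst 1%E x))%E); last first.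
    by rewrite integral_cst // mul1e hmu1 lee_fin invr1; lra.
  apply: ge0_le_integral => //.
  - by move=> x _; rewrite lee_fin powR_ge0.
  - by apply: measurable_funTS; exact: measurable_sharp_pV.
  - move=> x _; rewrite lee_fin.
    have /(ge1r_powR)/(_ dual_exponent_ge1) h : 0 < (W x)^-1 <= 1.
      by rewrite invr_gt0 W0 invf_le1 // sharp_p_ge1.
    by apply: (le_trans h); rewrite invf_le1 // sharp_p_ge1.
have KE : K n.+2 = K n.+1 `|` shell n by rewrite setDUK //;
    exact: (leu_nondecreasing hK).
have mS : measurable (shell n : set (borel G)) by exact: measurableD.
rewrite KE ge0_integral_setU //; first last.
- by rewrite disj_set2E; apply/eqP; rewrite setDIK.
- by move=> x _; rewrite lee_fin powR_ge0.
- by apply: measurable_funTS; exact: measurable_sharp_pV.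
pose m := fine (mu (shell n)); pose c := (n.+2%:R ^+ 2)^-1 : R.
have c0 : 0 < c by rewrite invr_gt0 exprn_gt0.
have c1 : c <= 1 by rewrite invf_le1 ?exprn_gt0 // exprn_ege1 // ler1n.
have shell_le : (\int[mu]_(x in shell n) ((W x)^-1 `^ q)%:E <= c%:E)%E.
  have [S0|/set0P[x0 [Kx0 nKx0]]] := eqVneq (shell n) set0.
    by rewrite S0 integral_set0 lee_fin ltW.
  have level_shell x : shell n x -> level x = n.+1.
    move=> [/levelP h1 /levelP /negP]; rewrite -ltnNge => h2.
    by apply/eqP; rewrite eqn_leq h1.
  have m1 : 1 <= m by exact: (shell_ge1 (level_shell x0 _)).
  have m0 : 0 < m by exact: lt_le_trans m1.
  apply: (@le_trans _ _ (\int[mu]_(x in shell n) (cst (c * m^-1)%:E x))%E); last first.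
    rewrite integral_cst // -(fineK (shell_fin n)) -EFinM lee_fin -/m.
    by rewrite mulfVK // gt_eqF.
  apply: ge0_le_integral => //.
  - by move=> x _; rewrite lee_fin powR_ge0.
  - by apply: measurable_funTS; exact: measurable_sharp_pV.
  move=> x Sx; rewrite lee_fin sharp_pE (level_shell x Sx) /sharp_p_level -/m.
  have mq0 : 0 < m `^ q^-1 by exact: powR_gt0.
  have b0 : 0 < a n.+2 + n.+2%:R ^+ 2.
    by rewrite ltr_pwDl ?exprn_ge0 // (lt_le_trans _ (sup_on_ge1 _)).
  rewrite invfM powRM ?invr_ge0 ?(ltW b0) ?(ltW mq0) //.
  have -> : ((m `^ q^-1)^-1) `^ q = m^-1.
    by rewrite -powRN -powRrM mulNr mulVf ?gt_eqF // powR_inv1 // ltW.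
  rewrite ler_wpM2r ?invr_ge0 ?(ltW m0) //.
  have bc : (a n.+2 + n.+2%:R ^+ 2)^-1 <= c.
    by rewrite lef_pV2 ?posrE ?exprn_gt0 // lerDr (le_trans _ (sup_on_ge1 _)).
  apply: le_trans bc; apply: ge1r_powR dual_exponent_ge1.
  by rewrite invr_gt0 b0 invf_le1 // (le_trans (sup_on_ge1 n.+1)) // lerDl exprn_ge0.
apply: (le_trans (leeD IH shell_le)); rewrite -EFinD lee_fin /c.
have n1 : 0 < (n.+1%:R : R) by rewrite ltr0n.
have -> : (n.+2%:R : R) = n.+1%:R + 1 by rewrite -natr1.
move: (n.+1%:R) n1 => t t0; rewrite -addrA lerD2l.
have -> : - (t + 1)^-1 = - t^-1 + (t * (t + 1))^-1 by field; rewrite !gt_eqF //; lra.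
rewrite lerD2l lef_pV2 ?posrE ?exprn_gt0 ?mulr_gt0 //; nra.
Qed.

Lemma integral_sharp_pV : (\int[mu]_x ((W x)^-1 `^ q)%:E <= 2%:E)%E.
Proof.
have := @ge0_nondecreasing_set_cvg_integral _ (borel G) R (fun n => K n.+1) (fun x =>
    ((W x)^-1 `^ q)%:E) mu.
rewrite (leu_cover hK) => h.
have {}h : (\int[mu]_(x in K n.+1) ((W x)^-1 `^ q)%:E)%E @[n --> \oo] --> (\int[mu]_x
    ((W x)^-1 `^ q)%:E)%E.
  apply: h => //.
  - by move=> n m nm; apply/subsetPset; exact: (leu_le hK).
  - by move=> n; apply: measurable_funTS; exact: measurable_sharp_pV.
  - by move=> n x _; rewrite lee_fin powR_ge0.
rewrite -(cvg_lim (@ereal_hausdorff R) h); apply: lime_le.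
  by apply/cvg_ex; eexists; exact: h.
apply: nearW => n; apply: (le_trans (integral_sharp_pV_K n)).
by rewrite lee_fin gerBl invr_ge0.
Qed.

Lemma Lp_sharp_pV : Lp mu q (fun x => ((W x)^-1)%:C%C).
Proof.
have W0 x : 0 <= (W x)^-1 by rewrite invr_ge0 (le_trans _ (sharp_p_ge1 x)).
split.
  split; last exact: measurable_cst.
  have -> : (fun x : borel G => complex.Re ((W x)^-1)%:C%C) = fun x =>
      (sharp_p_level (level x))^-1.
    by apply/funext => x; rewrite sharp_pE.
  exact: (measurable_level (fun n => (sharp_p_level n)^-1)).
rewrite /Lp_norm unlock poweR_lty //.
apply: (le_lt_trans _ (ltry 2)); apply: le_trans integral_sharp_pV.
rewrite le_eqVlt; apply/orP; left; apply/eqP; apply: eq_integral => x _.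
by rewrite normc_real /= ger0_norm // ger0_norm.
Qed.

Hypothesis index_nondecreasing : forall i j : nat, (0 < i)%N -> (i <= j)%N ->
  (subgroup_index (K i) (K i.+1) <= subgroup_index (K j) (K j.+1))%N.

(** [K n.+2] is the disjoint union of the cosets of the open subgroup [K n.+1],
    finitely many by compactness. *)
Lemma haar_index n :
  mu (K n.+2) = ((subgroup_index (K n.+1) (K n.+2))%:R%:E * mu (K n.+1))%E.
Proof.
have [_ MK VK] := leu_subgroup hK (ltn0Sn n).
have [_ MK' VK'] := leu_subgroup hK (ltn0Sn n.+1).
have KK : K n.+1 `<=` K n.+2 by exact: (leu_nondecreasing hK).
pose C := [set left_coset x (K n.+1) | x in K n.+2].
have cosetE x y : translate (K n.+1) x y ->
    left_coset x (K n.+1) = left_coset y (K n.+1).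
  rewrite /translate /= !left_cosetE => xy; apply/seteqP; split=> z;
      rewrite /translate /= => h.
    rewrite -[(y^-1 * z)%g](_ : (x^-1 * y)^-1 * (x^-1 * z) = _)%g;
        last by rewrite invgM invgK -mulgA mulVKg.
    by apply: MK => //; exact: VK.
  rewrite -[(x^-1 * z)%g](_ : (x^-1 * y) * (y^-1 * z) = _)%g;
      last by rewrite -mulgA mulVKg.
  exact: MK.
have fC : finite_set C.
  have := leu_compact hK (ltn0Sn n.+1); rewrite compact_cover.
  move=> /(_ G (K n.+2) (translate (K n.+1))).
  case=> [x _|x Kx|s sK Ks].
  - have oK := leu_open hK (ltn0Sn n).
    by move/continuousP: (@continuous_mull G x^-1%g); apply.
  - by exists x => //; rewrite /translate /= mulVg; exact: leu_one.
  - apply: (@sub_finite_set _ _ [set left_coset x (K n.+1) | x in [set` s]]).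
      move=> _ [x Kx <-]; have [y /= ys xy] := Ks x Kx.
      by exists y => //; exact: cosetE.
    exact: finite_image.
have KE : K n.+2 = \bigcup_(A in C) A.
  apply/seteqP; split=> [x Kx|x [_ [y Ky <-]]].
    exists (left_coset x (K n.+1)); first by exists x.
    by rewrite left_cosetE /translate /= mulVg; exact: leu_one.
  rewrite left_cosetE /translate /= => h; rewrite -(mulVKg y x).
  by apply: MK' => //; exact: KK.
rewrite {1}KE measure_fin_bigcup //; first last.
- by move=> _ [x _ <-]; rewrite left_cosetE; exact: measurable_translate.
- move=> _ _ [x _ <-] [y _ <-] [z []]; rewrite !left_cosetE => h1 h2.
  rewrite -!left_cosetE; rewrite (cosetE _ _ h1) (cosetE _ _ h2) //.
have mKf : mu (K n.+1) \is a fin_num by rewrite ge0_fin_numE // (haar_K_fin hK hmu).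
rewrite fsbig_finite // big_seq (eq_bigr (fun=> (fine (mu (K n.+1)))%:E)); last first.
  move=> A; rewrite in_fset_set // inE => -[x _ <-].
  by rewrite left_cosetE fineK //; exact: (haar_translate hmu x (mK n)).
rewrite -big_seq sumEFin big_const_seq count_predT iter_addr_0.
by rewrite -[in RHS](fineK mKf) -EFinM mulr_natl.
Qed.

Lemma haar_shellE n : fine (mu (shell n)) =
  ((subgroup_index (K n.+1) (K n.+2))%:R - 1) * fine (mu (K n.+1)).
Proof.
have mKf : mu (K n.+1) \is a fin_num by rewrite ge0_fin_numE // (haar_K_fin hK hmu).
have sE : mu (shell n) = (mu (K n.+2) - mu (K n.+1))%E.
  rewrite measureD //; last exact: (haar_K_fin hK hmu).
  by rewrite setIidr //; exact: (leu_nondecreasing hK).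
apply: EFin_inj; rewrite fineK ?shell_fin // sE haar_index -(fineK mKf).
by rewrite -EFinM -EFinB mulrBl mul1r.
Qed.

Lemma fine_haar_K_ge1 n : 1 <= fine (mu (K n.+1)).
Proof.
by rewrite -lee_fin fineK ?(haar_K_ge1 hK hmu1) // ge0_fin_numE // (haar_K_fin hK hmu).
Qed.

(** The measure of a shell is (index - 1) * mu (K n.+1), a product of two
    nondecreasing nonnegative factors. *)
Lemma shell_nondecreasing m n : (m <= n)%N ->
    fine (mu (shell m)) <= fine (mu (shell n)).
Proof.
move=> mn; rewrite !haar_shellE; apply: ler_pM.
- have h : 0 <= fine (mu (shell m)) by exact: fine_ge0.
  by move: h; rewrite haar_shellE pmulr_lge0 // (lt_le_trans _ (fine_haar_K_ge1 m)).
- exact: le_trans (fine_haar_K_ge1 m).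
- by rewrite lerD2r ler_nat; exact: index_nondecreasing.
- apply: fine_le; rewrite ?ge0_fin_numE ?(haar_K_fin hK hmu) //.
  by apply: le_haar => //; exact: (leu_le hK).
Qed.

Lemma sharp_p_weight : is_weight W /\ sub_additive W.
Proof.
have WE : W = fun x => sharp_p_level (level x) by apply/funext => x; exact: sharp_pE.
rewrite WE; apply: level_weight => [x|x y].
  by rewrite -sharp_pE; exact: sharp_p_ge1.
case Ey : (level y) => [|n]; first by rewrite leqn0 => /eqP ->.
have a0 i : 0 <= a i.+1 + i.+1%:R ^+ 2.
  by rewrite addr_ge0 ?exprn_ge0 // (le_trans _ (sup_on_ge1 _)).
case Ex : (level x) => [|m] /= mn.
  apply: (@le_trans _ _ (a n.+2 + n.+2%:R ^+ 2)).
    by rewrite lerD ?le_sup_on // exprn_ege1 // ler1n.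
  by rewrite ler_peMr // (shell_powR_ge1 Ey).
apply: ler_pM; rewrite ?powR_ge0 //.
  by rewrite lerD ?le_sup_on // ler_sqr ?nnegrE // ler_nat.
rewrite ge0_ler_powR ?nnegrE ?fine_ge0 //.
exact: shell_nondecreasing.
Qed.

End levels.

(** * Integrals of complex functions *)

Section complex_integral.
Variables (R : realType) (G : topologicalGroupType).
Variable mu : {measure set (borel G) -> \bar R}.
Implicit Types F H : G -> R[i].

(** [convolution mu f g x] is by definition the [cintegral] of
    [convolution_integrand f g x]. *)
Definition cintegral F : R[i] :=
  (\int[mu]_(y in [set: borel G]) Re (F y)) +i*
  (\int[mu]_(y in [set: borel G]) Im (F y)).

Definition cintegrable F :=
  complex_measurable F /\ (\int[mu]_(y in [set: borel G]) (normc (F y))%:E < +oo)%E.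

Lemma cintegrable_Re F : cintegrable F ->
  mu.-integrable [set: borel G] (EFin \o (fun y => Re (F y))).
Proof.
move=> [[mr mi] ff]; have mF := measurable_normc (conj mr mi).
apply: (@le_integrable _ _ _ mu setT measurableT _ (fun y => (normc (F y))%:E)).
- exact/measurable_EFinP.
- by move=> y _; rewrite /= lee_fin [leRHS]ger0_norm ?normc_ge0 // ler_normc_Re.
- apply/integrableP; split; first exact/measurable_EFinP.
  by under eq_integral do rewrite /= ger0_norm ?normc_ge0 //.
Qed.

Lemma cintegrable_Im F : cintegrable F ->
  mu.-integrable [set: borel G] (EFin \o (fun y => Im (F y))).
Proof.
move=> [[mr mi] ff]; have mF := measurable_normc (conj mr mi).
apply: (@le_integrable _ _ _ mu setT measurableT _ (fun y => (normc (F y))%:E)).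
- exact/measurable_EFinP.
- by move=> y _; rewrite /= lee_fin [leRHS]ger0_norm ?normc_ge0 // ler_normc_Im.
- apply/integrableP; split; first exact/measurable_EFinP.
  by under eq_integral do rewrite /= ger0_norm ?normc_ge0 //.
Qed.

Lemma integrable_RZ (r : R) (u : G -> R) :
  mu.-integrable [set: borel G] (EFin \o (u : borel G -> R)) ->
  mu.-integrable [set: borel G] (EFin \o (fun y : borel G => r * u y)).
Proof. by move=> iu; apply: eq_integrable (integrableZl measurableT r iu). Qed.

Lemma cintegral_linear (a : R[i]) F H : cintegrable F -> cintegrable H ->
  cintegral (a *: F + H) = a * cintegral F + cintegral H.
Proof.
move=> iF iH; have Fr := cintegrable_Re iF; have Fi := cintegrable_Im iF.
have Hr := cintegrable_Re iH; have Hi := cintegrable_Im iH.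
have E1 : \int[mu]_(y in [set: borel G]) Re ((a *: F + H) y) =
    Re a * (\int[mu]_y Re (F y)) - Im a * (\int[mu]_y Im (F y)) + \int[mu]_y Re (H y).
  rewrite -!RintegralZl // -RintegralB //; [|exact: integrable_RZ|exact: integrable_RZ].
  rewrite -RintegralD //.
    by apply: eq_Rintegral => y _; rewrite -Re_mul -Re_add.
  by apply: eq_integrable (integrableB measurableT (integrable_RZ (Re a) Fr)
      (integrable_RZ (Im a) Fi)).
have E2 : \int[mu]_(y in [set: borel G]) Im ((a *: F + H) y) =
    Re a * (\int[mu]_y Im (F y)) + Im a * (\int[mu]_y Re (F y)) + \int[mu]_y Im (H y).
  rewrite -!RintegralZl // -RintegralD //; [|exact: integrable_RZ|exact: integrable_RZ].
  rewrite -RintegralD //.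
    by apply: eq_Rintegral => y _; rewrite -Im_mul -Im_add.
  by apply: eq_integrable (integrableD measurableT (integrable_RZ (Re a) Fi)
      (integrable_RZ (Im a) Fr)).
by rewrite /cintegral E1 E2; apply/eqP;
    rewrite eq_complex Re_add Im_add Re_mul Im_mul /= !eqxx.
Qed.

(** Bounding the real and the imaginary part separately costs the factor 2, which
    is harmless for a norm that is submultiplicative up to a constant. *)
Lemma normc_cintegral_le F : complex_measurable F ->
  ((normc (cintegral F))%:E <= 2%:E * \int[mu]_(y in [set: borel G]) (normc (F
      y))%:E)%E.
Proof.
move=> mF; have [mr mi] := mF; have mN := measurable_normc mF.
have fineE (z : \bar R) : (`|fine z|%:E <= `|z|)%E by case: z => //=;
    rewrite normr0 leey.
have part (u : G -> R) : measurable_fun [set: borel G] (u : borel G -> R) ->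
    (forall y, `|u y| <= normc (F y)) ->
    (`|\int[mu]_(y in [set: borel G]) u y|%:E <= \int[mu]_(y in [set: borel G])
        (normc (F y))%:E)%E.
  move=> meas_u uF; apply: (le_trans (fineE _)).
  have mu' : measurable_fun [set: borel G] (fun y : borel G =>
      (u y)%:E) by exact/measurable_EFinP.
  apply: (le_trans (le_abse_integral mu measurableT mu')).
  apply: ge0_le_integral => //.
  - exact: measurableT_comp.
  - exact/measurable_EFinP.
  - by move=> y _; rewrite /= lee_fin.
have hr := part _ mr (fun y => ler_normc_Re (F y)).
have hi := part _ mi (fun y => ler_normc_Im (F y)).
apply: (@le_trans _ _ (`|Re (cintegral F)|%:E + `|Im (cintegral F)|%:E)%E).
  by rewrite -EFinD lee_fin normc_ReIm_le.
rewrite (_ : 2%:E = 1%:E + 1%:E)%E; last by rewrite -EFinD.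
by rewrite ge0_muleDl // !mul1e; exact: leeD.
Qed.

End complex_integral.

(** * Convolution of complex functions *)

Section convolution.
Variables (R : realType) (G : topologicalGroupType) (K : nat -> set G).
Hypothesis hK : locally_elliptic_union K.
Variable mu : {measure set (borel G) -> \bar R}.
Hypothesis hmu : left_haar_measure mu.
Hypothesis hmu1 : mu (K 1%N) = 1%E.
Implicit Types f g h : G -> R[i].

Definition absconv f g : borel G -> \bar R :=
  nnconv mu (fun y => (normc (f y))%:E) (fun y => (normc (g y))%:E).

Lemma nnmeasurable_normc f : complex_measurable f ->
  nnmeasurable (fun y : borel G => (normc (f y))%:E : \bar R).
Proof.
move=> mf; split; first by apply/measurable_EFinP; exact: measurable_normc.
by move=> y; rewrite lee_fin normc_ge0.
Qed.

Lemma complex_measurable_integrand f g x : complex_measurable f ->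
    complex_measurable g ->
  complex_measurable (convolution_integrand f g x).
Proof.
move=> [fr fi] [gr gi]; have mx := @measurable_invg_mul G x.
have grx := measurableT_comp gr mx; have gix := measurableT_comp gi mx.
split.
  apply: (eq_measurable_fun (fun y : borel G =>
      Re (f y) * Re (g (y^-1 * x)%g) - Im (f y) * Im (g (y^-1 * x)%g))).
    by move=> y _; rewrite -Re_mul.
  by apply: measurable_funB; exact: measurable_funM.
apply: (eq_measurable_fun (fun y : borel G =>
    Re (f y) * Im (g (y^-1 * x)%g) + Im (f y) * Re (g (y^-1 * x)%g))).
  by move=> y _; rewrite -Im_mul.
by apply: measurable_funD; exact: measurable_funM.
Qed.

Lemma absconvE f g x :
  (\int[mu]_(y in [set: borel G]) (normc (convolution_integrand f g x y))%:E)%E =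
      absconv f g x.
Proof. by apply: eq_integral => y _; rewrite Normc.normcM EFinM. Qed.

Lemma cintegrable_integrand f g x : complex_measurable f -> complex_measurable g ->
  (absconv f g x < +oo)%E -> cintegrable mu (convolution_integrand f g x).
Proof.
by move=> mf mg h; split; [exact: complex_measurable_integrand|rewrite absconvE].
Qed.

Lemma measurable_Rintegral_section (Phi : borel G * borel G -> R) :
  measurable_fun setT Phi ->
  measurable_fun [set: borel G] (fun x : borel G =>
    \int[mu]_(y in [set: borel G]) Phi (y, (y^-1 * x)%g)).
Proof.
move=> mPhi; apply: (measurableT_comp (fine_measurable measurableT)).
have mP : measurable_fun setT (EFin \o Phi) by exact/measurable_EFinP.
have mp : measurable_fun setT ((EFin \o Phi)^\+)%E by exact: measurable_funepos.
have mn : measurable_fun setT ((EFin \o Phi)^\-)%E by exact: measurable_funeneg.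
apply: (eq_measurable_fun (fun x : borel G => (\int[mu]_y ((EFin \o Phi)^\+) (y,
    (y^-1 * x)%g) -
  \int[mu]_y ((EFin \o Phi)^\-) (y, (y^-1 * x)%g))%E)).
  move=> x _; rewrite [RHS]integralE; congr (_ - _)%E; apply: eq_integral => y _;
      by rewrite ?funeposE ?funenegE.
apply: emeasurable_funB; apply: (measurable_conv_integral hK hmu) => //.
Qed.

Lemma complex_measurable_convolution f g : complex_measurable f ->
    complex_measurable g ->
  complex_measurable (convolution mu f g).
Proof.
move=> [fr fi] [gr gi].
have mfst (u : borel G -> R) : measurable_fun setT u ->
    measurable_fun setT (fun z : borel G * borel G => u z.1).
  by move=> m; exact: measurableT_comp measurable_fst.
have msnd (u : borel G -> R) : measurable_fun setT u ->
    measurable_fun setT (fun z : borel G * borel G => u z.2).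
  by move=> m; exact: measurableT_comp measurable_snd.
split.
  apply: (measurable_Rintegral_section (Phi := fun z : borel G * borel G =>
      Re (f z.1 * g z.2))).
  apply: (eq_measurable_fun (fun z : borel G * borel G =>
      Re (f z.1) * Re (g z.2) - Im (f z.1) * Im (g z.2))).
    by move=> z _; rewrite -Re_mul.
  by apply: measurable_funB; apply: measurable_funM;
      [exact: (mfst (fun y => Re (f y)))|exact: (msnd (fun y =>
          Re (g y)))|exact: (mfst (fun y => Im (f y)))|exact: (msnd (fun y =>
              Im (g y)))].
apply: (measurable_Rintegral_section (Phi := fun z : borel G * borel G =>
    Im (f z.1 * g z.2))).
apply: (eq_measurable_fun (fun z : borel G * borel G =>
    Re (f z.1) * Im (g z.2) + Im (f z.1) * Re (g z.2))).
  by move=> z _; rewrite -Im_mul.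
by apply: measurable_funD; apply: measurable_funM;
    [exact: (mfst (fun y => Re (f y)))|exact: (msnd (fun y =>
        Im (g y)))|exact: (mfst (fun y => Im (f y)))|exact: (msnd (fun y => Re (g y)))].
Qed.

Lemma convolution_linearl (a : R[i]) f g h x :
  complex_measurable f -> complex_measurable g -> complex_measurable h ->
  (absconv f h x < +oo)%E -> (absconv g h x < +oo)%E ->
  convolution mu (a *: f + g) h x = a * convolution mu f h x + convolution mu g h x.
Proof.
move=> mf mg mh fh gh.
rewrite -(cintegral_linear _ (cintegrable_integrand mf mh fh) (cintegrable_integrand
    mg mh gh)).
rewrite /convolution -/(cintegral _ _); congr (cintegral mu _).
apply/funext => y; rewrite /convolution_integrand.
rewrite [(a *: f + g) y](_ : _ = a * f y + g y) // mulrDl -mulrA; reflexivity.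
Qed.

Lemma convolution_linearr (a : R[i]) f g h x :
  complex_measurable f -> complex_measurable g -> complex_measurable h ->
  (absconv f g x < +oo)%E -> (absconv f h x < +oo)%E ->
  convolution mu f (a *: g + h) x = a * convolution mu f g x + convolution mu f h x.
Proof.
move=> mf mg mh fg fh.
rewrite -(cintegral_linear _ (cintegrable_integrand mf mg fg) (cintegrable_integrand
    mf mh fh)).
rewrite /convolution -/(cintegral _ _); congr (cintegral mu _).
apply/funext => y; rewrite /convolution_integrand.
rewrite [(a *: g + h) _](_ : _ = a * g (y^-1 * x)%g + h (y^-1 * x)%g) // mulrDr
    mulrCA; reflexivity.
Qed.

(** Null sets are invariant under inversion, by unimodularity, and under left
    translations. *)
Lemma ae_invg_mul (P : borel G -> Prop) x : {ae mu, forall y, P y} ->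
  {ae mu, forall y : borel G, P (y^-1 * x)%g}.
Proof.
move=> [N [mN N0 PN]]; exists (translate (invs N) x : set (borel G)); split.
- by apply: measurable_translate; exact: measurable_invs.
- rewrite (haar_translate hmu) ?(haar_invs hK hmu hmu1) //; exact: measurable_invs.
- by move=> y nP; apply/translate_invs; exact: PN.
Qed.

Lemma eq_convolution f f' g g' : complex_measurable f -> complex_measurable f' ->
  complex_measurable g -> complex_measurable g' ->
  ae_eq mu [set: borel G] (f : borel G -> _) f' ->
  ae_eq mu [set: borel G] (g : borel G -> _) g' ->
  convolution mu f g = convolution mu f' g'.
Proof.
move=> mf mf' mg mg' ff' gg'; apply/funext => x.
have [mr mi] := complex_measurable_integrand x mf mg.
have [mr' mi'] := complex_measurable_integrand x mf' mg'.
have ae : {ae mu, forall y : borel G,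
    convolution_integrand f g x y = convolution_integrand f' g' x y}.
  have := @ae_invg_mul (fun y => setT y -> g y = g' y) x gg'.
  move: ff'; apply: filterS2 => y e1 e2; rewrite /convolution_integrand.
  by rewrite (e1 I) (e2 I).
rewrite /convolution; congr (fine _ +i* fine _); apply: ae_eq_integral => //;
    try exact/measurable_EFinP.
  by apply: filterS ae => y -> _.
by apply: filterS ae => y -> _.
Qed.

(** The substitution y |-> x^-1 y turns one integrand into the conjugate of the
    other. The identity holds at every x: when a real or imaginary part has no finite
    integral, [fine] yields 0 on both sides. *)
Lemma convolution_involution f g x :
  complex_measurable f -> complex_measurable g ->
  involution (convolution mu f g) x = convolution mu (involution g) (involution f) x.
Proof.
move=> mf mg; rewrite /involution.
have [mr mi] := complex_measurable_integrand (x^-1)%g mf mg.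
rewrite {1}/convolution /=.
have E y : convolution_integrand (involution g) (involution f) x y =
    ((convolution_integrand f g (x^-1)%g (x^-1 * y)%g)^*)%C.
  rewrite /convolution_integrand /involution !invgM !invgK -mulgA mulgV mulg1.
  by rewrite mulrC rmorphM.
rewrite /convolution; congr (_ +i* _).
  rewrite /Rintegral.
  have <- := haar_integral_mull hmu x^-1%g (f := fun y =>
      (Re (convolution_integrand f g (x^-1)%g y))%:E); last exact/measurable_EFinP.
  congr fine; apply: eq_integral => y _; rewrite E.
  by case: (convolution_integrand _ _ _ _).
rewrite /Rintegral.
have <- := haar_integral_mull hmu x^-1%g (f := fun y =>
    (Im (convolution_integrand f g (x^-1)%g y))%:E); last exact/measurable_EFinP.
set F := fun y : borel G => (Im (convolution_integrand f g (x^-1)%g (x^-1 * y)%g))%:E.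
rewrite -/F.
have -> : (\int[mu]_(y in [set: borel G]) (Im (convolution_integrand (involution g)
    (involution f) x y))%:E = \int[mu]_y (- F y))%E.
  by apply: eq_integral => y _; rewrite E /F; case: (convolution_integrand _ _ _ _).
rewrite integralE [X in _ = fine X]integralE.
rewrite (eq_integral _ _ (fun y _ => congr1 (fun h : _ -> _ => h y) (funeposN F))).
rewrite (eq_integral _ _ (fun y _ => congr1 (fun h : _ -> _ => h y) (funenegN F))).
have := @integral_ge0 _ _ _ mu setT _ (fun y _ => funepos_ge0 F y).
have := @integral_ge0 _ _ _ mu setT _ (fun y _ => funeneg_ge0 F y).
move: (\int[mu]_(x in _) _)%E (\int[mu]_(x in _) _)%E => A B.
by case: A => [A| |] //; case: B => [B| |] //= _ _; rewrite ?oppr0 // opprB.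
Qed.

End convolution.

(** * The Banach algebra structure *)

Section algebra.
Variables (R : realType) (G : topologicalGroupType) (K : nat -> set G).
Hypothesis hK : locally_elliptic_union K.
Variable mu : {measure set (borel G) -> \bar R}.
Hypothesis hmu : left_haar_measure mu.
Hypothesis hmu1 : mu (K 1%N) = 1%E.
Variables (p : R) (W : G -> R) (C0 : R).
Hypothesis hp : 1 <= p.
Hypothesis hW : is_weight W.
Hypothesis C0_gt0 : 0 < C0.
Implicit Types f g h : G -> R[i].
Local Notation D := (Lpw mu p W).
Local Notation nrm := (Lpw_norm mu p W).
Local Notation wabs := (wmod W).
Local Notation wint := (wpow mu p W).
Local Notation conv := (convolution mu).
Local Notation eqv := (fun f g : G -> R[i] => ae_eq mu [set: borel G] (f : borel G ->
    _) g).

Definition weighted_pow f : borel G -> \bar R := fun y => (wabs f y `^ p)%:E.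

(** Besides the weight axioms, this pointwise estimate of W * (|f| * |g|) is all that
    the construction of the algebra uses about W. *)
Hypothesis Hbound : forall f g, complex_measurable f -> complex_measurable g ->
  forall x, ((W x)%:E * absconv mu f g x <=
    C0%:E * (nnconv mu (weighted_pow f) (weighted_pow g) x) `^ p^-1)%E.

Let mW := weight_measurable hW.
Let W1 := weight_ge1 hW.
Let p0 : 0 < p. Proof. exact: lt_le_trans hp. Qed.
Let pn0 : p != 0. Proof. by rewrite gt_eqF. Qed.
Let W_gt0 x : 0 < W x. Proof. exact: lt_le_trans (W1 x). Qed.

Lemma Lpw_measurable f : D f -> complex_measurable f.
Proof. by case/(LpwP mu hp mW W1). Qed.

Lemma nnmeasurable_weighted_pow f : complex_measurable f ->
    nnmeasurable (weighted_pow f).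
Proof.
by move=> mf; split; [exact: measurable_wmodX|move=> x; rewrite lee_fin powR_ge0].
Qed.

Lemma ae_nnconv_fin f g : D f -> D g ->
  {ae mu, forall x, (nnconv mu (weighted_pow f) (weighted_pow g) x < +oo)%E}.
Proof.
move=> Df Dg; have mf := Lpw_measurable Df; have mg := Lpw_measurable Dg.
have nf := nnmeasurable_weighted_pow mf; have ng := nnmeasurable_weighted_pow mg.
have [mc c0] := nnmeasurable_nnconv hK hmu nf ng.
have : mu.-integrable setT (nnconv mu (weighted_pow f) (weighted_pow g)).
  apply/integrableP; split=> //.
  under eq_integral do rewrite gee0_abs //.
  rewrite (integral_nnconv hK hmu hmu1 nf ng).
  apply: lte_mul_pinfty; first exact: wpow_ge0.
    exact: (wpow_fin_num hp mW W1 Df).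
  exact: ((LpwP mu hp mW W1 g).1 Dg).2.
move=> /(integrable_ae measurableT); apply: filterS => x /(_ I) h.
by rewrite -ge0_fin_numE.
Qed.

Lemma absconv_fin f g x : complex_measurable f -> complex_measurable g ->
  (nnconv mu (weighted_pow f) (weighted_pow g) x < +oo)%E -> (absconv mu f g x < +oo)%E.
Proof.
move=> mf mg hfin.
have : ((W x)%:E * absconv mu f g x < +oo)%E.
  apply: (le_lt_trans (Hbound mf mg x)).
  by rewrite lte_mul_pinfty ?lee_fin ?(ltW C0_gt0) // poweR_lty.
have [_ /(_ x)] := nnmeasurable_nnconv hK hmu (nnmeasurable_normc mf)
    (nnmeasurable_normc mg).
rewrite -/(absconv mu f g); case: (absconv mu f g x) => [r| |] //= _;
    first by move=> _; exact: ltry.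
by rewrite gt0_muley ?lte_fin.
Qed.

Lemma ae_absconv_fin f g : D f -> D g -> {ae mu, forall x, (absconv mu f g x < +oo)%E}.
Proof.
move=> Df Dg; apply: filterS (ae_nnconv_fin Df Dg) => x.
by apply: absconv_fin; exact: Lpw_measurable.
Qed.

Lemma convolution_exists_Lpw f g : D f -> D g -> convolution_exists mu f g.
Proof.
move=> Df Dg; apply: filterS (ae_absconv_fin Df Dg) => x hfin.
have [mi ii] := cintegrable_integrand (Lpw_measurable Df) (Lpw_measurable Dg) hfin.
apply/integrableP; split; first by apply/measurable_EFinP; exact: measurable_normc.
by under eq_integral do rewrite /= ger0_norm ?normc_ge0 //.
Qed.

(** The integral of the p-th power of [Hbound], computed by [integral_nnconv]. It is
    harmless that the value of a convolution carries no information where the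
    integral diverges, since the right-hand integrand is +oo there. *)
Lemma wpow_convolution_le f g : D f -> D g ->
  (wint (conv f g) <= ((2 * C0) `^ p)%:E * (wint f * wint g))%E.
Proof.
move=> Df Dg; have mf := Lpw_measurable Df; have mg := Lpw_measurable Dg.
have nf := nnmeasurable_weighted_pow mf; have ng := nnmeasurable_weighted_pow mg.
have [mc c0] := nnmeasurable_nnconv hK hmu nf ng.
have mfg := complex_measurable_convolution hK hmu mf mg.
have C20 : 0 < (2 * C0) `^ p by rewrite powR_gt0 // mulr_gt0.
rewrite -(integral_nnconv hK hmu hmu1 nf ng) -ge0_integralZl //;
    last by rewrite lee_fin ltW.
apply: ge0_le_integral => //.
- by move=> x _; rewrite lee_fin powR_ge0.
- exact: measurable_wmodX.
- by apply: emeasurable_funM => //; exact: measurable_cst.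
move=> x _.
have [->|fin] := eqVneq (nnconv mu (weighted_pow f) (weighted_pow g) x) +oo%E.
  by rewrite gt0_muley ?lte_fin // leey.
have finc : nnconv mu (weighted_pow f) (weighted_pow g) x \is a fin_num.
  by rewrite ge0_fin_numE // ltey.
have h1 := normc_cintegral_le mu (complex_measurable_integrand x mf mg).
rewrite absconvE -/(conv f g x) in h1.
have h2 : ((wabs (conv f g) x)%:E <= (2 * C0)%:E * (nnconv mu (weighted_pow f)
    (weighted_pow g) x) `^ p^-1)%E.
  rewrite /wmod EFinM muleC;
      apply: (@le_trans _ _ ((W x)%:E * (2%:E * absconv mu f g x))%E).
    by rewrite lee_wpmul2l ?lee_fin ?(ltW (W_gt0 x)).
  rewrite muleCA EFinM -muleA lee_wpmul2l ?lee_fin //; exact: Hbound.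
have c0x := c0 x; rewrite -(fineK finc);
    rewrite -(fineK finc) poweR_EFin -EFinM lee_fin in h2.
have t0 : 0 <= fine (nnconv mu (weighted_pow f) (weighted_pow g) x) by exact: fine_ge0.
rewrite -EFinM lee_fin.
have -> : (2 * C0) `^ p * fine (nnconv mu (weighted_pow f) (weighted_pow g) x) =
   (2 * C0 * fine (nnconv mu (weighted_pow f) (weighted_pow g) x) `^ p^-1) `^ p.
  by rewrite [RHS]powRM ?mulr_ge0 ?powR_ge0 ?(ltW C0_gt0) // -powRrM mulVf // powRr1.
apply: ge0_ler_powR => //; rewrite ?nnegrE; first exact: ltW.
  exact: wmod_ge0.
by rewrite !mulr_ge0 ?powR_ge0 ?(ltW C0_gt0).
Qed.

Lemma Lpw_convolution f g : D f -> D g -> D (conv f g).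
Proof.
move=> Df Dg; have mf := Lpw_measurable Df; have mg := Lpw_measurable Dg.
apply/(LpwP mu hp mW W1); split; first exact: (complex_measurable_convolution hK hmu).
apply: (le_lt_trans (wpow_convolution_le Df Dg)).
rewrite -(Lpw_norm_pow hp W1 Df) -(Lpw_norm_pow hp W1 Dg) -!EFinM; exact: ltry.
Qed.

Lemma Lpw_normM f g : D f -> D g -> nrm (conv f g) <= (2 * C0) * (nrm f * nrm g).
Proof.
move=> Df Dg; have N0 := Lpw_norm_ge0 mu p W.
apply: (Lpw_norm_le hp W1 (Lpw_convolution Df Dg)).
  by rewrite !mulr_ge0 ?N0 ?(ltW C0_gt0).
apply: (le_trans (wpow_convolution_le Df Dg)).
rewrite -(Lpw_norm_pow hp W1 Df) -(Lpw_norm_pow hp W1 Dg) -!EFinM lee_fin.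
by rewrite !powRM ?mulr_ge0 ?N0 ?(ltW C0_gt0).
Qed.

Lemma Lpw_linear (a : R[i]) f g : D f -> D g -> D (a *: f + g).
Proof. by move=> Df Dg; apply: (LpwD hp mW W1) => //; exact: (LpwZ hp mW W1). Qed.

Lemma Lpw_mul_linearl (a : R[i]) f g h : D f -> D g -> D h ->
  eqv (conv (a *: f + g) h) (a *: conv f h + conv g h).
Proof.
move=> Df Dg Dh; move: (ae_absconv_fin Df Dh) (ae_absconv_fin Dg Dh).
apply: filterS2 => x fh gh _; rewrite convolution_linearl //; exact: Lpw_measurable.
Qed.

Lemma Lpw_mul_linearr (a : R[i]) f g h : D f -> D g -> D h ->
  eqv (conv f (a *: g + h)) (a *: conv f g + conv f h).
Proof.
move=> Df Dg Dh; move: (ae_absconv_fin Df Dg) (ae_absconv_fin Df Dh).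
apply: filterS2 => x fh gh _; rewrite convolution_linearr //; exact: Lpw_measurable.
Qed.

Lemma eqv_linear (a : R[i]) f f' g g' : eqv f f' -> eqv g g' ->
  eqv (a *: f + g) (a *: f' + g').
Proof.
apply: filterS2 => x /(_ I) e1 /(_ I) e2 _.
by rewrite [LHS](_ : _ = a * f x + g x) // e1 e2.
Qed.

Definition of_real (a : G -> R) : G -> R[i] := fun x => (a x)%:C%C.

(** f is a linear combination of the positive and negative parts of Re f and Im f,
    which are bounded by |f|. *)
Lemma Lpw_nonneg_ind (P : (G -> R[i]) -> Prop) :
  (forall a, (forall x, 0 <= a x) -> D (of_real a) -> P (of_real a)) ->
  (forall c f g, D f -> D g -> P f -> P g -> P (c *: f + g)) ->
  forall f, D f -> P f.
Proof.
move=> P0 PL f Df; have [mr mi] := Lpw_measurable Df.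
pose pos (u : G -> R) x := (`|u x| + u x) / 2.
have pos0 u x : 0 <= pos u x.
  by rewrite divr_ge0 // -lerBlDr sub0r -normrN ler_norm.
have posle u x : pos u x <= `|u x|.
  by rewrite ler_pdivrMr // mulr_natr mulr2n lerD2l ler_norm.
have mpos (u : G -> R) : measurable_fun [set: borel G] (u : borel G -> R) ->
    measurable_fun [set: borel G] (pos u : borel G -> R).
  move=> meas_u; apply: measurable_funM; last exact: measurable_cst.
  by apply: measurable_funD => //; exact: measurableT_comp.
have Dpos (u : G -> R) : measurable_fun [set: borel G] (u : borel G -> R) ->
    (forall x, `|u x| <= normc (f x)) -> D (of_real (pos u)).
  move=> meas_u uf; apply: (Lpw_le hp mW W1 _ _ Df).
    by split; [exact: mpos|exact: measurable_cst].
  by move=> x; rewrite normc_real ger0_norm // (le_trans (posle u x)).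
have mrN : measurable_fun [set: borel G] (fun x : borel G =>
    - Re (f x)) by exact: measurableT_comp.
have miN : measurable_fun [set: borel G] (fun x : borel G =>
    - Im (f x)) by exact: measurableT_comp.
have D1 := Dpos (fun x => Re (f x)) mr (fun x => ler_normc_Re _).
have D2 := Dpos (fun x => Im (f x)) mi (fun x => ler_normc_Im _).
have D3 : D (of_real (pos (fun x => - Re (f x)))).
  by apply: Dpos mrN _ => x; rewrite normrN ler_normc_Re.
have D4 : D (of_real (pos (fun x => - Im (f x)))).
  by apply: Dpos miN _ => x; rewrite normrN ler_normc_Im.
have -> : f = (-1) *: of_real (pos (fun x => - Re (f x))) +
    ('i%C *: of_real (pos (fun x => Im (f x))) +
    ((- 'i%C) *: of_real (pos (fun x => - Im (f x))) +
     of_real (pos (fun x => Re (f x))))).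
  apply/funext => x.
  rewrite [RHS](_ : _ = (-1) * (pos (fun x => - Re (f x)) x)%:C%C +
    ('i%C * (pos (fun x => Im (f x)) x)%:C%C +
    ((- 'i%C) * (pos (fun x => - Im (f x)) x)%:C%C + (pos (fun x =>
        Re (f x)) x)%:C%C))) //.
  rewrite /pos !normrN; case: (f x) => r i; apply/eqP;
      rewrite eq_complex !Re_add !Im_add !Re_mul !Im_mul /=.
  by apply/andP; split; apply/eqP; field.
have L2 := Lpw_linear (- 'i%C) D4 D1; have L3 := Lpw_linear 'i%C D2 L2.
apply: (PL) => //; first exact: P0.
apply: (PL) => //; first exact: P0.
by apply: (PL) => //; exact: P0.
Qed.

Lemma convolution_real (a b : G -> R) :
  conv (of_real a) (of_real b) =
  of_real (fun x => fine (nnconv mu (EFin \o a) (EFin \o b) x)).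
Proof.
apply/funext => x; rewrite /convolution /of_real.
have E1 : \int[mu]_(y in [set: borel G]) Re (convolution_integrand (of_real a)
    (of_real b) x y) =
    fine (nnconv mu (EFin \o a) (EFin \o b) x).
  rewrite /Rintegral; congr fine; apply: eq_integral => y _.
  by rewrite /convolution_integrand Re_mul /= mulr0 subr0.
have E2 : \int[mu]_(y in [set: borel G]) Im (convolution_integrand (of_real a)
    (of_real b) x y) = 0.
  rewrite /Rintegral (eq_integral (cst 0%E)) ?integral0 // => y _.
  by rewrite /convolution_integrand Im_mul /= mulr0 mul0r addr0.
by rewrite E1 E2.
Qed.

Lemma absconv_real (a b : G -> R) : (forall x, 0 <= a x) -> (forall x, 0 <= b x) ->
  absconv mu (of_real a) (of_real b) = nnconv mu (EFin \o a) (EFin \o b).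
Proof.
move=> a0 b0; rewrite /absconv; congr (nnconv mu _ _); apply/funext => y.
  by rewrite normc_real ger0_norm.
by rewrite normc_real ger0_norm.
Qed.

Lemma nnmeasurable_real (a : G -> R) : (forall x,
    0 <= a x) -> complex_measurable (of_real a) ->
  nnmeasurable (EFin \o a : borel G -> \bar R).
Proof. by move=> a0 [ma _]; split=> [|x]; [exact/measurable_EFinP|rewrite lee_fin]. Qed.

(** For nonnegative functions the identity is [nnconvA], at every point: replacing
    the values +oo of the inner convolutions by 0, as [fine] does, changes them on a
    null set only. *)
Lemma convolution_real_assoc (a b c : G -> R) :
  (forall x, 0 <= a x) -> (forall x, 0 <= b x) -> (forall x, 0 <= c x) ->
  D (of_real a) -> D (of_real b) -> D (of_real c) ->
  conv (of_real a) (conv (of_real b) (of_real c)) =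
  conv (conv (of_real a) (of_real b)) (of_real c).
Proof.
move=> a0 b0 c0 Da Db Dc.
have na := nnmeasurable_real a0 (Lpw_measurable Da).
have nb := nnmeasurable_real b0 (Lpw_measurable Db).
have nc := nnmeasurable_real c0 (Lpw_measurable Dc).
have nab := nnmeasurable_nnconv hK hmu na nb;
    have nbc := nnmeasurable_nnconv hK hmu nb nc.
rewrite !convolution_real; congr of_real; apply/funext => x; congr fine.
have nfine (F : borel G -> \bar R) : nnmeasurable F ->
    measurable_fun setT (fun y => (fine (F y))%:E).
  by move=> [mF _]; apply/measurable_EFinP;
      exact: (measurableT_comp (fine_measurable measurableT)).
transitivity (nnconv mu (EFin \o a) (nnconv mu (EFin \o b) (EFin \o c)) x).
  have fbc := ae_absconv_fin Db Dc; rewrite absconv_real // in fbc.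
  have := ae_invg_mul hK hmu hmu1 x fbc => aef.
  have mx := @measurable_invg_mul G x.
  apply: ae_eq_integral => //.
  - by apply: emeasurable_funM;
      [exact: na.1|exact: (measurableT_comp (nfine _ nbc) mx)].
  - by apply: emeasurable_funM; [exact: na.1|exact: (measurableT_comp nbc.1 mx)].
  - apply: filterS aef => y yfin _ /=; rewrite fineK // ge0_fin_numE //; exact: nbc.2.
rewrite (nnconvA hK hmu hmu1 na nb nc).
have fab := ae_absconv_fin Da Db; rewrite absconv_real // in fab.
have mx := @measurable_invg_mul G x.
apply: ae_eq_integral => //.
- by apply: emeasurable_funM; [exact: nab.1|exact: (measurableT_comp nc.1 mx)].
- by apply: emeasurable_funM; [exact: (nfine _ nab)|exact: (measurableT_comp nc.1 mx)].
- by apply: filterS fab => y yfin _ /=; rewrite fineK // ge0_fin_numE //; exact: nab.2.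
Qed.

(** Both sides are linear in each argument up to null sets, and convolutions do not
    see null sets, so [Lpw_nonneg_ind] reduces the claim to nonnegative functions. *)
Lemma convolution_assoc f g h : D f -> D g -> D h ->
  eqv (conv f (conv g h)) (conv (conv f g) h).
Proof.
have cc f1 f2 g1 g2 : D f1 -> D f2 -> D g1 -> D g2 -> eqv f1 f2 -> eqv g1 g2 ->
    conv f1 g1 = conv f2 g2.
  by move=> d1 d2 d3 d4; apply: (eq_convolution hK hmu hmu1); exact: Lpw_measurable.
have eqv_refl f1 : eqv f1 f1 by exact: ae_eq_refl.
have DM f1 f2 : D f1 -> D f2 -> D (conv f1 f2) by exact: Lpw_convolution.
have DL (k : R[i]) f1 f2 : D f1 -> D f2 -> D (k *: f1 + f2) by exact: Lpw_linear.
move=> Df Dg; move: h; apply: Lpw_nonneg_ind => [c c0 Dc|k h1 h2 D1 D2 IH1 IH2].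
  move: g Dg; apply: Lpw_nonneg_ind => [b b0 Db|k g1 g2 D1 D2 IH1 IH2].
    move: f Df; apply: Lpw_nonneg_ind => [a a0 Da|k f1 f2 D1 D2 IH1 IH2].
      by rewrite convolution_real_assoc.
    have e := cc _ _ _ _ (DM _ _ (DL k _ _ D1 D2) Db) (DL k _ _ (DM _ _ D1 Db) (DM _
        _ D2 Db)) Dc Dc
       (Lpw_mul_linearl k D1 D2 Db) (eqv_refl _).
    rewrite e; apply: ae_eq_trans (Lpw_mul_linearl k D1 D2 (DM _ _ Db Dc)) _.
    apply: ae_eq_trans (eqv_linear k IH1 IH2) _; apply: ae_eq_sym.
    exact: (Lpw_mul_linearl k (DM _ _ D1 Db) (DM _ _ D2 Db) Dc).
  have e1 := cc _ _ _ _ (DM _ _ Df (DL k _ _ D1 D2)) (DL k _ _ (DM _ _ Df D1) (DM _ _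
      Df D2)) Dc Dc
     (Lpw_mul_linearr k Df D1 D2) (eqv_refl _).
  have e2 := cc _ _ _ _ Df Df (DM _ _ (DL k _ _ D1 D2) Dc) (DL k _ _ (DM _ _ D1 Dc)
      (DM _ _ D2 Dc))
     (eqv_refl _) (Lpw_mul_linearl k D1 D2 Dc).
  rewrite e1 e2; apply: ae_eq_trans (Lpw_mul_linearr k Df (DM _ _ D1 Dc) (DM _ _ D2
      Dc)) _.
  apply: ae_eq_trans (eqv_linear k IH1 IH2) _; apply: ae_eq_sym.
  exact: (Lpw_mul_linearl k (DM _ _ Df D1) (DM _ _ Df D2) Dc).
have e2 := cc _ _ _ _ Df Df (DM _ _ Dg (DL k _ _ D1 D2)) (DL k _ _ (DM _ _ Dg D1) (DM
    _ _ Dg D2))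
   (eqv_refl _) (Lpw_mul_linearr k Dg D1 D2).
rewrite e2; apply: ae_eq_trans (Lpw_mul_linearr k Df (DM _ _ Dg D1) (DM _ _ Dg D2)) _.
apply: ae_eq_trans (eqv_linear k IH1 IH2) _; apply: ae_eq_sym.
exact: (Lpw_mul_linearr k (DM _ _ Df Dg) D1 D2).
Qed.

Lemma complex_measurable_involution f : complex_measurable f ->
    complex_measurable (involution f).
Proof.
move=> [mr mi]; have mv := @measurable_invg G; split.
  apply: (eq_measurable_fun (fun x : borel G => Re (f (x^-1)%g))).
    by move=> x _; rewrite /involution; case: (f _).
  exact: measurableT_comp mr mv.
apply: (eq_measurable_fun (fun x : borel G => - Im (f (x^-1)%g))).
  by move=> x _; rewrite /involution; case: (f _).
by apply: measurableT_comp => //; exact: measurableT_comp mi mv.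
Qed.

Lemma wpow_involution f : complex_measurable f -> wint (involution f) = wint f.
Proof.
move=> mf; rewrite /wpow -(haar_integral_invg hK hmu hmu1 (f := weighted_pow f)).
  apply: eq_integral => x _; rewrite /weighted_pow /wmod /involution normc_conj.
  by rewrite (weight_inv hW x).
exact: measurable_wmodX.
Qed.

Lemma Lpw_involution f : D f -> D (involution f).
Proof.
move=> Df; have mf := Lpw_measurable Df; apply/(LpwP mu hp mW W1); split.
  exact: complex_measurable_involution.
by rewrite wpow_involution //; exact: ((LpwP mu hp mW W1 f).1 Df).2.
Qed.

Lemma Lpw_norm_involution f : D f -> nrm (involution f) = nrm f.
Proof.
by move=> Df; rewrite /Lpw_norm !(Lp_norm_wpowE mu hp W1) wpow_involution //;
    exact: Lpw_measurable.
Qed.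

Lemma Lp_weight_of_bound : is_Lp_weight mu p W.
Proof.
split; [exact: hW|exact: convolution_exists_Lpw|split].
- exact: (Lpw_0 mu hp mW W1).
- exact: Lpw_linear.
- by move=> f g Df Dg; exact: (Lpw_eqP hp mW W1).
- by move=> f _; exact: Lpw_norm_ge0.
- by move=> f g; exact: (Lpw_normD hp mW W1).
- by move=> a f; exact: (Lpw_normZ hp mW W1).
- exact: (Lpw_complete hp mW W1).
- exact: Lpw_convolution.
- exact: convolution_assoc.
- exact: Lpw_mul_linearl.
- exact: Lpw_mul_linearr.
- by exists (2 * C0); [rewrite mulr_gt0|exact: Lpw_normM].
- exact: Lpw_involution.
- move=> a f g Df Dg; apply: aeW => x _; rewrite /involution.
  rewrite [(a *: f + g) _](_ : _ = a * f (x^-1)%g + g (x^-1)%g) //.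
  by rewrite rmorphD rmorphM.
- by move=> f Df; apply: aeW => x _; rewrite /involution invgK conjcK.
- move=> f g Df Dg; apply: aeW => x _.
  by apply: (convolution_involution hmu); exact: Lpw_measurable.
- exact: Lpw_norm_involution.
Qed.

End algebra.

(** * Pointwise bounds for convolutions *)

Section bound.
Variables (R : realType) (G : topologicalGroupType) (K : nat -> set G).
Hypothesis hK : locally_elliptic_union K.
Variable mu : {measure set (borel G) -> \bar R}.
Hypothesis hmu : left_haar_measure mu.
Hypothesis hmu1 : mu (K 1%N) = 1%E.
Variables (p : R) (W : G -> R).
Hypothesis hW : is_weight W.
Implicit Types f g : G -> R[i].

Let mW := weight_measurable hW.
Let W1 := weight_ge1 hW.
Let W_gt0 x : 0 < W x. Proof. exact: lt_le_trans (W1 x). Qed.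

Lemma measurable_wmod_section g x : complex_measurable g ->
  measurable_fun [set: borel G] (fun y : borel G => wmod W g (y^-1 * x)%g).
Proof.
by move=> mg; exact: (measurableT_comp (measurable_wmod mW mg) (@measurable_invg_mul
    G x)).
Qed.

Lemma weight_absconvE f g x : complex_measurable f -> complex_measurable g ->
  ((W x)%:E * absconv mu f g x =
   \int[mu]_y (W x * (normc (f y) * normc (g (y^-1 * x)%g)))%:E)%E.
Proof.
move=> mf mg; rewrite /absconv /nnconv -ge0_integralZl //.
- have [m _] := nnmeasurableM (nnmeasurable_normc mf)
    (nnmeasurable_comp (measurable_invg_mul x) (nnmeasurable_normc mg)).
  exact: m.
- by move=> y _; rewrite mule_ge0 // lee_fin normc_ge0.
- by rewrite lee_fin ltW.
Qed.

Lemma measurable_absconv_integrand f g x : complex_measurable f ->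
    complex_measurable g ->
  measurable_fun [set: borel G] (fun y : borel G =>
      W x * (normc (f y) * normc (g (y^-1 * x)%g))).
Proof.
move=> mf mg; apply: measurable_funM; first exact: measurable_cst.
apply: measurable_funM; first exact: measurable_normc.
exact: (measurableT_comp (measurable_normc mg) (@measurable_invg_mul G x)).
Qed.

Lemma weight_split x y : W x <= W y * W (y^-1 * x)%g.
Proof. by have := weight_mul hW y (y^-1 * x)%g; rewrite mulVKg. Qed.

(** For p = 1 the estimate [Hbound] is W x <= W y * W (y^-1 x), integrated. *)
Lemma Lp_weight_1 : is_Lp_weight mu 1 W.
Proof.
apply: (Lp_weight_of_bound hK hmu hmu1 (lexx 1) hW ltr01) => f g mf mg x.
have mfx := measurable_wmod mW mf; have mgx := measurable_wmod_section x mg.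
rewrite mul1e invr1 poweRe1; last first.
  by apply: integral_ge0 => y _; rewrite mule_ge0 // lee_fin powR_ge0.
rewrite weight_absconvE //; apply: ge0_le_integral => //.
- by move=> y _; rewrite lee_fin !mulr_ge0 ?normc_ge0 ?(ltW (W_gt0 _)).
- by apply/measurable_EFinP; exact: measurable_absconv_integrand.
- apply: (eq_measurable_fun (fun y : borel G =>
    (wmod W f y * wmod W g (y^-1 * x)%g)%:E)).
    by move=> y _; rewrite /weighted_pow !powRr1 ?(wmod_ge0 W1).
  by apply/measurable_EFinP; exact: measurable_funM.
move=> y _; rewrite /weighted_pow -EFinM lee_fin !powRr1 ?(wmod_ge0 W1) // /wmod.
by rewrite mulrACA [leRHS]mulrC ler_wpM2r ?mulr_ge0 ?normc_ge0 // weight_split.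
Qed.

Hypothesis p1 : 1 < p.
Variables (q C : R).
Hypothesis q1 : 1 <= q.
Hypothesis pq : p^-1 + q^-1 = 1.
Hypothesis C_gt0 : 0 < C.
Hypothesis hC : forall x y : G, W (x * y)%g <= C * (W x + W y).
Hypothesis hV : Lp mu q (fun x => ((W x)^-1)%:C%C).

Let p0 : 0 < p. Proof. exact: lt_trans p1. Qed.
Let q0 : 0 < q. Proof. exact: lt_le_trans q1. Qed.
Let V (y : borel G) : R := (W y)^-1.
Let mV : measurable_fun [set: borel G] V. Proof. by have [[]] := hV. Qed.
Let NV := Lnorm mu q%:E (EFin \o V).

Let NV_fin : (NV < +oo)%E.
Proof.
have [_] := hV; rewrite /Lp_norm (_ : (fun _ => _) = EFin \o V) //.
by apply/funext => x; rewrite normc_real ger0_norm // invr_ge0 ltW.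
Qed.

Lemma Lnorm_V_section x : Lnorm mu q%:E (EFin \o (fun y : borel G =>
    V (y^-1 * x)%g)) = NV.
Proof.
rewrite /NV unlock; congr (_ `^ _)%E.
have m : measurable_fun [set: borel G] (fun y : borel G => (`|(EFin \o V) y| `^ q)%E).
  apply: (eq_measurable_fun (fun y : borel G => (`|V y| `^ q)%:E)) => //.
  apply/measurable_EFinP; apply: (measurableT_comp (measurable_powR _)).
  exact: measurableT_comp.
rewrite -(haar_integral_mull hmu x^-1%g m); apply: eq_integral => y _ /=.
by rewrite /V (weight_inv hW (y^-1 * x)%g) invgM invgK.
Qed.

(** Subadditivity reads W x / (W y * W (y^-1 x)) <= C (1 / W y + 1 / W (y^-1 x)).
    The norm in L^q of the right-hand side, as a function of y, is bounded
    independently of x, so Hoelder's inequality for |f y| W y * |g (y^-1 x)| W (y^-1 x)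
    against it is [Hbound]. *)
Lemma Lp_weight_sub_additive : is_Lp_weight mu p W.
Proof.
pose B := fine NV.
have NV0 : (0 <= NV)%E by exact: Lnorm_ge0.
have B0 : 0 <= B by exact: fine_ge0.
(* the summand 1 makes the constant positive when B is 0 *)
have C0 : 0 < C * (2 * B) + 1 by rewrite ltr_wpDl // !mulr_ge0 // ltW.
apply: (Lp_weight_of_bound hK hmu hmu1 (ltW p1) hW C0) => f g mf mg x.
have mfx := measurable_wmod mW mf; have mgx := measurable_wmod_section x mg.
have mVx : measurable_fun [set: borel G] (fun y : borel G => V (y^-1 * x)%g).
  exact: (measurableT_comp mV (@measurable_invg_mul G x)).
pose F (y : borel G) := wmod W f y * wmod W g (y^-1 * x)%g.
pose H (y : borel G) := V y + V (y^-1 * x)%g.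
have mF : measurable_fun [set: borel G] F by exact: measurable_funM.
have mH : measurable_fun [set: borel G] H by exact: measurable_funD.
have F0 y : 0 <= F y by rewrite mulr_ge0 ?(wmod_ge0 W1).
have V0 y : 0 <= V y by rewrite invr_ge0 ltW.
have H0 y : 0 <= H y by rewrite addr_ge0.
have hH : (Lnorm mu q%:E (EFin \o H) <= (2 * B)%:E)%E.
  apply: (le_trans (minkowski_EFin mu mV mVx q1)).
  rewrite Lnorm_V_section -/NV -(@fineK _ NV) ?ge0_fin_numE // -/B -EFinD lee_fin.
  by rewrite mulr_natl mulr2n.
have hF : Lnorm mu p%:E (EFin \o F) = (nnconv mu (weighted_pow p W f) (weighted_pow p
    W g) x `^ p^-1)%E.
  rewrite unlock; congr (_ `^ _)%E; apply: eq_integral => y _.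
  by rewrite /= ger0_norm // powRM ?(wmod_ge0 W1).
have hFH : (\int[mu]_y (F y * H y)%:E <= Lnorm mu p%:E (EFin \o F) * (2 * B)%:E)%E.
  apply: (@le_trans _ _ (Lnorm mu p%:E (EFin \o F) * Lnorm mu q%:E (EFin \o H))%E).
    have := hoelder mu mF mH p0 q0 pq; rewrite Lnorm1.
    rewrite (eq_integral (fun y : borel G => (F y * H y)%:E)) // => y _.
    by rewrite /= ger0_norm // mulr_ge0.
  by apply: lee_wpmul2l => //; exact: Lnorm_ge0.
have mFH : measurable_fun [set: borel G] (fun y : borel G => (F y * H y)%:E).
  by apply/measurable_EFinP; exact: measurable_funM.
apply: (@le_trans _ _ (C%:E * \int[mu]_y (F y * H y)%:E)%E).
  rewrite weight_absconvE // -ge0_integralZl //; last first.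
  - by rewrite lee_fin ltW.
  - by move=> y _; rewrite lee_fin mulr_ge0.
  apply: ge0_le_integral => //.
  - by move=> y _; rewrite lee_fin !mulr_ge0 ?normc_ge0 ?(ltW (W_gt0 _)).
  - by apply/measurable_EFinP; exact: measurable_absconv_integrand.
  - by apply: emeasurable_funM => //; exact: measurable_cst.
  - move=> y _; rewrite -EFinM lee_fin /F /H /V /wmod.
    set z := (y^-1 * x)%g; have Wxy : W x <= C * (W y + W z) by have := hC y z;
        rewrite mulVKg.
    have -> : C * (normc (f y) * W y * (normc (g z) * W z) * ((W y)^-1 + (W z)^-1)) =
       C * (W y + W z) * (normc (f y) * normc (g z)) by field; rewrite !gt_eqF.
    by rewrite ler_wpM2r ?mulr_ge0 ?normc_ge0.
apply: (@le_trans _ _ (C%:E * (Lnorm mu p%:E (EFin \o F) * (2 * B)%:E))%E).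
  by apply: lee_wpmul2l => //; rewrite lee_fin ltW.
rewrite hF (muleC (_ `^ _)%E) muleA -EFinM lee_wpmul2r ?poweR_ge0 //.
by rewrite lee_fin lerDl.
Qed.

End bound.

Unset Implicit Arguments.

Theorem proposition3p5 (R : realType) (G : topologicalGroupType)
    (K : nat -> set G) (hK : locally_elliptic_union K)
    (mu : {measure set (borel G) -> \bar R}) (hmu : left_haar_measure mu)
    (hmu1 : mu (K 1%N) = 1%E)
    (p : R) (hp : 1 <= p) (w : G -> R) (hw : is_weight w) :
  [/\ is_weight (sharp w K), sub_additive (sharp w K),
      (forall x : G, w x <= sharp w K x <= sharp_p mu w K p x) &
      Lp mu (dual_exponent p) (fun x => ((sharp_p mu w K p x)^-1)%:C)] /\
  ((forall i j : nat, (0 < i)%N -> (i <= j)%N ->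
      (subgroup_index (K i) (K i.+1) <= subgroup_index (K j) (K j.+1))%N) ->
   is_Lp_weight mu p (sharp_p mu w K p) /\ sub_additive (sharp_p mu w K p)).
Proof.
have [wS sS] := sharp_weight hK hw.
have LV := Lp_sharp_pV hK hmu hmu1 hp hw.
split; first by split=> //; exact: (sharp_le_sharp_p hK hmu hmu1 hp hw).
move=> hi; have [wP sP] := sharp_p_weight hK hmu hmu1 hp hw hi; split=> //.
have [p1|p1] := eqVneq p 1.
  rewrite {1}p1; exact: (Lp_weight_1 hK hmu hmu1 wP).
have [C C0 hC] := sP; have p1' : 1 < p by rewrite lt_neqAle eq_sym p1.
apply: (Lp_weight_sub_additive hK hmu hmu1 wP p1' (dual_exponent_ge1 hp) _ C0 hC LV).
rewrite /dual_exponent (negbTE p1) invf_div; field.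
by rewrite gt_eqF // (lt_trans ltr01).
Qed.
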